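(* Let $y\in\mathcal Q_A$, let $\{a_n\}_{n\in\mathbb N}$ be a sequence in $A$ and let $R\in\mathbb R^+\cup\{+\infty\}$ (where $\mathbb R^+=\{t\in\mathbb R: t\ge 0\}$) be defined by $$\limsup_{n\to+\infty}\big(\|a_n\|_A\big)^{1/n}=\frac1R .$$ Then the following two statements hold. (i) The power series $\mathrm P(x)=\sum_{n\in\mathbb N}(x-y)^{\cdot n}a_n$ converges totally on compact subsets of $\mathcal Q_A$ contained in $\Sigma_A(y,R)$. If $\{a_n\}_{n\in\mathbb N}\subset\mathcal Q_A$, then $\mathrm P$ does not converge on $\mathcal Q_A\setminus\mathrm{clos}(\Sigma_A(y,R))$. One calls $R$ the $\sigma_A$-radius of convergence of $\mathrm P$. (ii) The spherical series $\mathrm S(x)=\sum_{n\in\mathbb N}\mathscr S_{y,n}(x)a_n$ converges totally on compact subsets of $\mathcal Q_A$ contained in $\mathrm U_A(y,R)$. If $\{a_n\}_{n\in\mathbb N}\subset\mathcal Q_A$, then $\mathrm S$ does not converge on $\mathcal Q_A\setminus\mathrm{clos}(\mathrm U_A(y,R))$. One calls $R$ the $\mathrm u_A$-radius of convergence of $\mathrm S$.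
   Context: Algebra. $A$ is a finite-dimensional real alternative algebra with unity $1$ (so $\mathbb R\subset A$), equipped with a real linear anti-involution $x\mapsto x^c$ (so $(x^c)^c=x$, $(xy)^c=y^cx^c$). Put $t(x):=x+x^c$, $n(x):=xx^c$. The quadratic cone is $\mathcal Q_A:=\mathbb R\cup\{x\in A: t(x)\in\mathbb R,\ n(x)\in\mathbb R,\ 4n(x)>t(x)^2\}$; $\mathbb S_A:=\{J\in\mathcal Q_A: J^2=-1\}$ is assumed non-empty; for $J\in\mathbb S_A$, $\mathbb C_J:=\mathbb R+\mathbb RJ\simeq\mathbb C$. One has $\mathcal Q_A=\bigcup_{J}\mathbb C_J$ and $\mathbb C_I\cap\mathbb C_J=\mathbb R$ if $I\ne\pm J$. For $x\in\mathcal Q_A$: $\mathrm{Re}(x):=(x+x^c)/2\in\mathbb R$, $\mathrm{Im}(x):=(x-x^c)/2$. $A$ is equipped with a norm $\|\cdot\|_A$ such that $\|x\|_A=\sqrt{n(x)}$ for all $x\in\mathcal Q_A$. $\mathcal Q_A$ carries the euclidean topology (the one induced by $\|\cdot\|_A$), and $\mathrm{clos}(S)$ is the closure of $S$ in $\mathcal Q_A$. Slice functions. A map $F=F_1+iF_2:\mathbb C\to A\otimes_{\mathbb R}\mathbb C$ with $F_1(\bar z)=F_1(z)$, $F_2(\bar z)=-F_2(z)$ (a stem function) induces the slice function $\mathcal I(F):\mathcal Q_A\to A$, $\mathcal I(F)(\alpha+\beta J):=F_1(\alpha+i\beta)+JF_2(\alpha+i\beta)$ for $\alpha,\beta\in\mathbb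 R$, $J\in\mathbb S_A$. Series. For $y\in\mathcal Q_A$, $(x-y)^{\cdot n}$ is the value at $x$ of the slice function induced by $z\mapsto(z-y)^n$, and for $a\in A$, $(x-y)^{\cdot n}a$ is the value at $x$ of the slice function induced by $z\mapsto(z-y)^na$. Put $\Delta_y(x):=x^2-x\,t(y)+n(y)$, $\mathscr S_{y,2m}(x):=\Delta_y(x)^m$, $\mathscr S_{y,2m+1}(x):=\Delta_y(x)^m(x-y)$ for $m\in\mathbb N$; $\mathscr S_{y,n}(x)a$ is the value at $x$ of the slice function induced by $z\mapsto\mathscr S_{y,n}(z)a$ (products in $A\otimes_{\mathbb R}\mathbb C$). A series of functions $\sum_n g_n$ converges totally on a set $L$ if $\sum_n\sup_{x\in L}\|g_n(x)\|_A<+\infty$. Balls. For $x,y\in\mathcal Q_A$, $y\in\mathbb C_J$: $\sigma_A(x,y):=\|x-y\|_A$ if $x\in\mathbb C_J$, and $\sigma_A(x,y):=\sqrt{|\mathrm{Re}(x)-\mathrm{Re}(y)|^2+(\|\mathrm{Im}(x)\|_A+\|\mathrm{Im}(y)\|_A)^2}$ if $x\notin\mathbb C_J$ (a metric on $\mathcal Q_A$). $\mathrm u_A(x,y):=\sqrt{\|\Delta_y(x)\|_A}$ (a pseudo-metric on $\mathcal Q_A$). $\Sigma_A(y,r):=\{x\in\mathcal Q_A:\sigma_A(x,y)<r\}$, $\mathrm U_A(y,r):=\{x\in\mathcal Q_A:\mathrm u_A(x,y)<r\}$. Conventions: $1/0=+\infty$, $1/(+\infty)=0$.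
   Formalization: In (i), for y non-real and |Im y|<R<∞, total convergence is claimed only for compact sets contained in some Σ_A(y,s) with s<R (false otherwise); when R=0, divergence excludes x=y in (i) and points with u_A(x,y)=0 in (ii), where the series converge. *)

(* Defs.v *)
From HB Require Import structures.
From mathcomp Require Import all_boot all_order all_algebra.
From mathcomp Require Import sesquilinear complex.
From mathcomp Require Import all_classical all_reals all_analysis.

Set Implicit Arguments.
Unset Strict Implicit.
Unset Printing Implicit Defensive.

Import Order.TTheory GRing.Theory Num.Theory.
Import numFieldNormedType.Exports.

Local Open Scope classical_set_scope.
Local Open Scope ring_scope.

(* The product is not assumed to be associative, so the ring structures of the
   library do not apply.  [alt_mulC] is the real linear anti-involution. *)
Record alt_star_algebra (R : realType) (A : normedModType R) := AltStarAlgebra {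
  alt_mul : {bilinear A -> A -> A};
  alt_one : A;
  alt_conj : {linear A -> A};
  alt_one_neq0 : alt_one != 0;
  alt_mul1l : forall x, alt_mul alt_one x = x;
  alt_mul1r : forall x, alt_mul x alt_one = x;
  alt_left : forall x y, alt_mul (alt_mul x x) y = alt_mul x (alt_mul x y);
  alt_right : forall x y, alt_mul (alt_mul y x) x = alt_mul y (alt_mul x x);
  alt_conjK : forall x, alt_conj (alt_conj x) = x;
  alt_conjM : forall x y,
    alt_conj (alt_mul x y) = alt_mul (alt_conj y) (alt_conj x) }.

Definition finite_dimensional (R : realType) (A : normedModType R) :=
  exists (n : nat) (e : 'I_n -> A),
    forall x, exists c : 'I_n -> R, x = \sum_i c i *: e i.

Section quadratic_cone.
Context {R : realType} {A : normedModType R} (D : alt_star_algebra A).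
Local Notation "x ** y" := (alt_mul D x y) (at level 40, left associativity).
Local Notation "x ^c" := (alt_conj D x).

(* the embedding of the real numbers into A *)
Definition areal (s : R) : A := s *: alt_one D.

Definition atr (x : A) : A := x + x^c.
Definition anm (x : A) : A := x ** x^c.
Definition aRe (x : A) : A := 2^-1 *: (x + x^c).
Definition aIm (x : A) : A := 2^-1 *: (x - x^c).

Definition quadratic_cone : set A :=
  range areal `|`
  [set x | exists t n : R,
     [/\ atr x = areal t, anm x = areal n & t ^+ 2 < 4 * n]].

Definition imag_units : set A :=
  [set J | quadratic_cone J /\ J ** J = - alt_one D].

Definition Cslice (J : A) : set A :=
  [set x | exists a b : R, x = areal a + b *: J].

Definition norm_compatible :=
  forall x, quadratic_cone x ->
    forall n : R, anm x = areal n -> `|x| = Num.sqrt n.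

(* closure relative to the quadratic cone *)
Definition closQ (S : set A) : set A := quadratic_cone `&` closure S.

(* The complexification of A: the pair (u, v) stands for u + i v. *)
Definition AC : Type := (A * A)%type.

Definition acmul (w1 w2 : AC) : AC :=
  (w1.1 ** w2.1 - w1.2 ** w2.2, w1.1 ** w2.2 + w1.2 ** w2.1).

Definition acexp (w : AC) (n : nat) : AC := iter n (acmul w) (alt_one D, 0).

Definition ac_of_A (a : A) : AC := (a, 0).
Definition ac_of_C (z : R[i]) : AC :=
  (areal (complex.Re z), areal (complex.Im z)).

Definition stem (F : R[i] -> AC) :=
  forall a b : R, F (Complex a (- b)) = ((F (Complex a b)).1, - (F (Complex a b)).2).

(* The value at a point of the quadratic cone does not depend on the choice of
   a, b, J when F is a stem function: see [slice_funE] below. *)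
Definition slice_fun (F : R[i] -> AC) (x : A) : A :=
  xget 0 [set v | exists a b J, [/\ imag_units J, x = areal a + b *: J &
    v = (F (Complex a b)).1 + J ** (F (Complex a b)).2]].

Definition power_stem (y : A) (n : nat) (a : A) (z : R[i]) : AC :=
  acmul (acexp (ac_of_C z - ac_of_A y) n) (ac_of_A a).

Definition power_term (y : A) (n : nat) (a : A) : A -> A :=
  slice_fun (power_stem y n a).

Definition Delta (y x : A) : A := x ** x - x ** atr y + anm y.

Definition acDelta (y : A) (w : AC) : AC :=
  acmul w w - acmul w (ac_of_A (atr y)) + ac_of_A (anm y).

Definition spherical_poly (y : A) (n : nat) (w : AC) : AC :=
  if odd n then acmul (acexp (acDelta y w) n./2) (w - ac_of_A y)
  else acexp (acDelta y w) n./2.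

Definition spherical_stem (y : A) (n : nat) (a : A) (z : R[i]) : AC :=
  acmul (spherical_poly y n (ac_of_C z)) (ac_of_A a).

Definition spherical_term (y : A) (n : nat) (a : A) : A -> A :=
  slice_fun (spherical_stem y n a).

(* For real y every x in the cone falls under the first case, and there the two
   expressions agree; otherwise y lies on a single slice.  The norm of A is the
   absolute value on the real line.
   For non-real y this distance to y jumps across the slice of y and is not
   upper semicontinuous for the norm topology.  When |Im y| < r < +oo it can
   therefore have supremum r on a norm-compact subset of the open r-ball, and
   on such a set a power series of radius r need not converge totally: with
   quaternions take y = i, r = 2, a_n = 2^-n, and the points x_k = (1 - d_k) I_k
   together with their limit i, where I_k != i, I_k --> i, d_k = |I_k - i|^2. *)
Definition sigma_dist (x y : A) : R :=
  if `[< exists J, [/\ imag_units J, Cslice J y & Cslice J x] >] then `|x - y|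
  else Num.sqrt (`|aRe x - aRe y| ^+ 2 + (`|aIm x| + `|aIm y|) ^+ 2).

Definition u_dist (x y : A) : R := Num.sqrt `|Delta y x|.

Definition sigma_ball (y : A) (r : \bar R) : set A :=
  [set x | quadratic_cone x /\ ((sigma_dist x y)%:E < r)%E].

Definition u_ball (y : A) (r : \bar R) : set A :=
  [set x | quadratic_cone x /\ ((u_dist x y)%:E < r)%E].

End quadratic_cone.

Definition converges_totally (R : realType) (A : normedModType R)
    (g : nat -> A -> A) (L : set A) :=
  (\sum_(0 <= n <oo) ereal_sup [set `|g n x|%:E | x in L] < +oo)%E.

Definition converges_at (R : realType) (A : normedModType R)
    (g : nat -> A -> A) (x : A) := cvgn (series (fun n => g n x)).

Section slice_functions.
Context {R : realType} {A : normedModType R} (D : alt_star_algebra A).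
Local Notation "x ** y" := (alt_mul D x y) (at level 40, left associativity).

Let acconj (w : A * A) : A * A := (w.1, - w.2).

Let acconjM (v w : A * A) : acconj (acmul D v w) = acmul D (acconj v) (acconj w).
Proof.
by rewrite /acconj /acmul /= linearNr linearNl linearNr opprK opprD linearNl.
Qed.

Let acconjD (v w : A * A) : acconj (v + w) = acconj v + acconj w.
Proof. by rewrite /acconj /= opprD. Qed.

Let acconjN (w : A * A) : acconj (- w) = - acconj w.
Proof. by []. Qed.

Let acconjA a : acconj (ac_of_A a) = ac_of_A a.
Proof. by rewrite /acconj /= oppr0. Qed.

Let acconjX w n : acconj (acexp D w n) = acexp D (acconj w) n.
Proof.
elim: n => [|n IH]; first by rewrite /acconj /= oppr0.
by rewrite /acexp !iterS acconjM -/(acexp D w n) IH.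
Qed.

Let acconjC (a b : R) : ac_of_C D (Complex a (- b)) = acconj (ac_of_C D (Complex a b)).
Proof. by rewrite /ac_of_C /acconj /areal /= scaleNr. Qed.

Lemma power_stemP y n a : stem (power_stem D y n a).
Proof.
move=> s t; rewrite -/(acconj _) /power_stem acconjC.
by rewrite acconjM acconjX acconjD acconjN !acconjA.
Qed.

Lemma spherical_stemP y n a : stem (spherical_stem D y n a).
Proof.
have acconjDelta w : acconj (acDelta D y w) = acDelta D y (acconj w).
  by rewrite /acDelta !(acconjD, acconjN, acconjM, acconjA).
move=> s t; rewrite -/(acconj _) /spherical_stem acconjC.
rewrite acconjM acconjA /spherical_poly; case: odd; last by rewrite acconjX acconjDelta.
by rewrite acconjM acconjX acconjDelta acconjD acconjN acconjA.
Qed.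

Let conj1 : alt_conj D (alt_one D) = alt_one D.
Proof.
have := alt_conjM D (alt_conj D (alt_one D)) (alt_one D).
by rewrite alt_mul1r alt_conjK alt_mul1r.
Qed.

Let realM (s : R) (x : A) : areal D s ** x = s *: x.
Proof. by rewrite /areal linearZl_LR alt_mul1l. Qed.

Let Mreal (s : R) (x : A) : x ** areal D s = s *: x.
Proof. by rewrite /areal linearZr_LR alt_mul1r. Qed.

Let unit_not_real J s : imag_units D J -> J <> areal D s.
Proof.
move=> [_ JJ] Js; move: JJ; rewrite Js realM /areal scalerA => /eqP.
rewrite -subr_eq0 opprK -[X in _ + X]scale1r -scalerDl scaler_eq0.
rewrite (negbTE (alt_one_neq0 D)) orbF => /eqP h.
by have := sqr_ge0 s; rewrite leNgt expr2 -[s * s](addrK 1) h sub0r oppr_lt0 ltr01.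
Qed.

Let unit_conj J : imag_units D J -> alt_conj D J = - J.
Proof.
move=> uJ; have [QJ JJ] := uJ.
case: QJ => [[s _ /esym /unit_not_real -/(_ uJ) //]|[t [n [Jt Jn _]]]].
have Jc : alt_conj D J = areal D t - J by rewrite -Jt /atr addrC addKr.
move: Jn; rewrite /anm Jc linearBr /= Mreal JJ opprK => /eqP.
rewrite -subr_eq0 -addrA -[X in _ + (X - _)]scale1r /areal -scalerBl => h.
have [t0|t0] := eqVneq t 0; first by rewrite t0 /areal scale0r sub0r.
case: (@unit_not_real J (t^-1 * (n - 1)) uJ).
rewrite /areal -scalerA; move: h; rewrite addr_eq0 -scaleNr opprB => /eqP <-.
by rewrite scalerA mulVf // scale1r.
Qed.

Let slice_coord (a b a' b' : R) J J' : imag_units D J -> imag_units D J' ->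
  areal D a + b *: J = areal D a' + b' *: J' -> a = a' /\ b *: J = b' *: J'.
Proof.
move=> uJ uJ' e; have := congr1 (alt_conj D) e.
rewrite /areal !linearD !linearZ /=.
rewrite (unit_conj uJ) (unit_conj uJ') conj1 !scalerN => e'.
have aa : a = a'.
  have : (a + a - (a' + a')) *: alt_one D = 0.
    rewrite scalerBl !scalerDl; apply/eqP; rewrite subr_eq0; apply/eqP.
    rewrite /areal in e; have := congr2 +%R e e'.
    by rewrite addrACA subrr addr0 addrACA subrr addr0 => ->.
  move/eqP; rewrite scaler_eq0 (negbTE (alt_one_neq0 D)) orbF subr_eq0 => /eqP.
  rewrite -!mulr2n => /eqP; rewrite eqrMn2r //= => /eqP //.
by split=> //; move: e; rewrite aa => /addrI.
Qed.

Lemma slice_funE F a b J : stem F -> imag_units D J ->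
  slice_fun D F (areal D a + b *: J)
    = (F (Complex a b)).1 + J ** (F (Complex a b)).2.
Proof.
move=> Fstem uJ; apply: xget_unique; first by exists a, b, J.
move=> v [a' [b' [J' [uJ' e ->]]]].
have [<- bJ] := slice_coord uJ uJ' e.
have bb : b ^+ 2 = b' ^+ 2.
  have := congr1 (fun x => x ** x) bJ.
  rewrite /= !linearZl_LR !linearZr_LR /= uJ.2 uJ'.2 !scalerA -!expr2.
  move/eqP; rewrite !scalerN eqr_opp -subr_eq0 -scalerBl scaler_eq0.
  by rewrite (negbTE (alt_one_neq0 D)) orbF subr_eq0 => /eqP.
have [b0|b0] := eqVneq b 0.
  have b'0 : b' = 0 by apply/eqP; rewrite -sqrf_eq0 -bb b0 expr0n.
  rewrite b0 b'0; have := Fstem a 0; rewrite oppr0.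
  case: (F _) => p q /= [] /eqP; rewrite -subr_eq0 opprK -mulr2n -scaler_nat.
  by rewrite scaler_eq0 pnatr_eq0 /= => /eqP ->; rewrite !linear0r.
move/eqP: bb; rewrite eqf_sqr => /orP[] /eqP bb; move: bJ; rewrite bb.
  by rewrite bb in b0; move=> /(scalerI b0) ->.
have b'0 : b' != 0 by rewrite -oppr_eq0 -bb.
rewrite scaleNr -scalerN => /(scalerI b'0) <-.
by rewrite Fstem /= linearNr linearNl.
Qed.

End slice_functions.

(* Main.v *)
Require Import Defs.
From mathcomp Require Import all_boot all_order all_algebra.
From mathcomp Require Import complex.
From mathcomp Require Import all_classical all_reals all_analysis.
From mathcomp Require Import ring lra.

(* Everything reduces to complex numbers.  For [x = s + t J] and [y] on the slice of
   [I], write [c = s + i t] and let [d] be the complex coordinate of [y].  Then twice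
   [J] times the n-th term of the power series is
     (I + J) ((c - d)^n a_n) + (J - I) ((c^* - d)^n a_n),
   where the powers are read in C_I.  With the sign of [I] well chosen, either [I = J]
   and the second summand vanishes, or [|c^* - d| < |c - d|]; in both cases [|c - d|]
   is the sigma-distance.  Hence the term is at most a constant times
   [|c - d|^n |a_n|], and it has this size when the first summand is not small.
   This last point needs [|K (u a)| >= const |K| |u| |a|] for [u], [a] in the cone and
   arbitrary [K]: here [K = I + J] may be a zero divisor and three elements of an
   alternative algebra need not associate, but the middle Moufang identity gives
   [K (u a) = a ((a^-1 K) u) a], where all factors but [K] are invertible.
   The n-th spherical term is [Delta_y(x)^m a_n] or [Delta_y(x)^m ((x - y) a_n)] with
   the power in C_J, so its size is comparable to [u(x, y)^n |a_n|].  The root test then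
   yields convergence and divergence; points whose distance to [y] equals a positive
   radius are limits, along segments, of points at smaller distance. *)

Set Implicit Arguments.
Unset Strict Implicit.
Unset Printing Implicit Defensive.

Import Order.TTheory GRing.Theory Num.Theory.
Import numFieldNormedType.Exports.

Local Open Scope classical_set_scope.
Local Open Scope ring_scope.

Local Notation normc := ComplexField.Normc.normc.
Local Notation Re := complex.Re.
Local Notation Im := complex.Im.

(** * Finite dimension, root test and total convergence *)

(** A spanning family of minimal size is free, so the linear map it defines on row vectors has no
    zero on the compact unit sphere; the inverse of its minimal norm there serves as [M]. *)
Lemma finite_dimensional_coord (R : realType) (A : normedModType R) :
  finite_dimensional A -> exists (n : nat) (e : 'I_n -> A) (M : R), 0 <= M /\
    forall x, exists c : 'I_n -> R,
      x = \sum_i c i *: e i /\ forall i, `|c i| <= M * `|x|.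
Proof.
move=> [n0 [e0 span0]].
pose spans n := `[< exists e : 'I_n -> A,
  forall x, exists c : 'I_n -> R, x = \sum_i c i *: e i >].
have exn : exists n, spans n by exists n0; apply/asboolP; exists e0.
case: (ex_minnP exn) => n /asboolP[e span_e] min_n.
have free_e (c : 'I_n -> R) : \sum_i c i *: e i = 0 -> forall i, c i = 0.
  move=> c0 k; apply/eqP/negPn/negP => ck.
  (* If [c k != 0], the relation expresses [e k] through the other members, which then already
     span. *)
  case: n => [|m] in e span_e min_n c c0 k ck *; first by case: k ck.
  have : (m.+1 <= m)%N; last by rewrite ltnn.
  apply/min_n/asboolP; exists (e \o lift k) => x.
  have [d ->] := span_e x.
  have ek : e k = \sum_i (- (c k)^-1 * c (lift k i)) *: e (lift k i).
    apply: (scalerI ck); rewrite scaler_sumr.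
    move/eqP: c0; rewrite (bigD1_ord k) //= addr_eq0 => /eqP ->.
    rewrite -sumrN; apply: eq_bigr => i _.
    by rewrite scalerA mulrA mulrN mulfV // mulN1r scaleNr.
  exists (fun i => d k * (- (c k)^-1 * c (lift k i)) + d (lift k i)).
  rewrite (bigD1_ord k) //= {1}ek scaler_sumr -big_split /=.
  by apply: eq_bigr => i _; rewrite scalerA scalerDl.
(* The empty family is treated apart: row vectors of length 0 have an empty unit sphere. *)
case: n => [|n] in e span_e min_n free_e *.
  exists 0%N, e, 0; split=> // x; have [c cx] := span_e x.
  by exists c; split=> // -[].
pose f (v : 'rV[R]_n.+1) : A := \sum_i v ord0 i *: e i.
have fcont : continuous f.
  apply: (continuous_big add_continuous) => i _ v.
  exact: (cvgZr_tmp (@coord_continuous R 1 n.+1 ord0 i v)).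
pose S := [set v : 'rV[R]_n.+1 | `|v| = 1].
have S0 : S !=set0.
  pose v : 'rV[R]_n.+1 := const_mx 1.
  have v0 : v != 0.
    by apply/eqP => /rowP/(_ ord0)/eqP; rewrite !mxE oner_eq0.
  exists (`|v|^-1 *: v); rewrite /S /= normrZ ger0_norm ?invr_ge0 //.
  by rewrite mulVf // normr_eq0.
have cS : compact S.
  apply: bounded_closed_compact.
    by exists 1; split=> // t t1 v /= ->; exact: ltW.
  have -> : S = Num.norm @^-1` [set 1] by [].
  by apply: preimage_closed; [move=> v _; exact: norm_continuous|exact: closed_eq].
have [|v0 v0S v0min] := @EVT_min_rV R _ (fun v => `|f v|) S S0 cS.
  apply: continuous_subspaceT => v.
  by apply: continuous_comp; [exact: fcont|exact: norm_continuous].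
have f0 : 0 < `|f v0|.
  rewrite normr_gt0; apply/eqP => /free_e v00.
  move: v0S; rewrite inE /S /= (_ : v0 = 0) ?normr0 => [/esym/eqP|].
    by rewrite oner_eq0.
  by apply/rowP => i; rewrite mxE v00.
exists n.+1, e, `|f v0|^-1; split=> [|x]; first by rewrite invr_ge0.
have [c cx] := span_e x; exists c; split=> // i.
pose v : 'rV[R]_n.+1 := \row_j c j.
have fv : f v = x by rewrite cx; apply: eq_bigr => j _; rewrite mxE.
apply: (@le_trans _ _ `|v|).
  rewrite [leRHS]/Num.norm /= mx_normrE; apply/bigmax_geP; right.
  by exists (ord0, i); rewrite //= mxE.
have [->|v_neq0] := eqVneq v 0; first by rewrite normr0 mulr_ge0 ?invr_ge0.
have nv0 : 0 < `|v| by rewrite normr_gt0.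
have fZ : f (`|v|^-1 *: v) = `|v|^-1 *: x.
  by rewrite -fv /f scaler_sumr; apply: eq_bigr => j _; rewrite mxE scalerA.
have /v0min : `|v|^-1 *: v \in S.
  by rewrite inE /S /= normrZ ger0_norm ?invr_ge0 // mulVf ?gt_eqF.
rewrite fZ normrZ ger0_norm ?invr_ge0 // ler_pdivlMl // => vx.
by rewrite ler_pdivlMl // mulrC.
Qed.

Lemma bounded_bilinear (R : realType) (A : normedModType R)
    (f : {bilinear A -> A -> A}) : finite_dimensional A ->
  exists2 C : R, 0 < C & forall x y, `|f x y| <= C * `|x| * `|y|.
Proof.
move=> /finite_dimensional_coord[n [e [M [M0 coord]]]].
(* The summand 1 keeps the constant positive even if all products of the [e i] vanish. *)
exists (M ^+ 2 * (\sum_i \sum_j `|f (e i) (e j)|) + 1).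
  by rewrite ltr_wpDl // mulr_ge0 ?exprn_ge0 // !sumr_ge0 // => i _; rewrite sumr_ge0.
move=> x y; have [c [cx cM]] := coord x; have [d [dy dM]] := coord y.
apply: (@le_trans _ _ (M ^+ 2 * (\sum_i \sum_j `|f (e i) (e j)|) * `|x| * `|y|)).
  rewrite {1}cx {1}dy linear_sumlz /=.
  apply: le_trans (ler_norm_sum _ _ _) _.
  rewrite mulr_sumr !mulr_suml; apply: ler_sum => i _.
  rewrite linear_sumr /=; apply: le_trans (ler_norm_sum _ _ _) _.
  rewrite mulr_sumr !mulr_suml; apply: ler_sum => j _.
  rewrite linearZl_LR linearZr_LR /= !normrZ.
  rewrite (_ : _ * _ * _ * _ = (M * `|x|) * ((M * `|y|) * `|f (e i) (e j)|)).
    by rewrite !ler_pM // ?mulr_ge0.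
  by ring.
by rewrite !ler_wpM2r // lerDl.
Qed.

(** The maximum is attained in [L], hence stays strictly below [r]. *)
Lemma compact_lt_bound (R : realType) (T : topologicalType) (f : T -> R)
    (L : set T) (r : \bar R) :
  L !=set0 -> compact L -> continuous f ->
  (forall x, L x -> ((f x)%:E < r)%E) ->
  exists2 s : R, (s%:E < r)%E & forall x, L x -> f x <= s.
Proof.
move=> L0 cL fc fr.
have [c cL' cmax] := compact_EVT_max L0 cL (continuous_subspaceT fc).
exists (f c); first by apply: fr; rewrite inE in cL'.
by move=> x Lx; apply: cmax; rewrite inE.
Qed.

(** In this form a strict inequality on the limsup produces an index, or a term in every tail. *)
Lemma limn_esup_inf (R : realType) (u : (\bar R)^nat) :
  limn_esup u = ereal_inf (range (esups u)).
Proof. by rewrite limn_esup_lim; exact/cvg_lim/cvg_esups_inf. Qed.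

Lemma powR_invn_expn (R : realType) (x : R) n : 0 <= x -> (0 < n)%N ->
  (x `^ n%:R^-1) ^+ n = x.
Proof.
move=> x0 n0; rewrite -powR_mulrn ?powR_ge0 // -powRrM mulVf ?powRr1 //.
by rewrite pnatr_eq0 -lt0n.
Qed.

Lemma root_test_lt (R : realType) (u : nat -> R) (r : \bar R) (s : R) :
  (forall n, 0 <= u n) ->
  limn_esup (fun n => (u n `^ n%:R^-1)%:E) = (r^-1)%E ->
  0 < s -> (s%:E < r)%E ->
  exists C q : R, [/\ 0 <= q, q < 1 & forall n, u n * s ^+ n <= C * q ^+ n].
Proof.
move=> u0 ur s0 sr.
(* [t] lies strictly between [s] and [r]; the roots are eventually at most [t^-1], so the ratio will
   be [s / t]. *)
have [t [st tr]] : exists t : R, s < t /\ (r^-1 < (t^-1)%:E)%E.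
  case: r sr {ur} => [r||] //.
    rewrite lte_fin => sr; exists ((s + r) / 2); split; first by lra.
    by rewrite inver gt_eqF ?lte_fin ?ltf_pV2 ?posrE; lra.
  by move=> _; exists (s + 1); rewrite ltrDl invey lte_fin invr_gt0; split; lra.
have t0 : 0 < t by lra.
(* At index 0 the exponent [0%:R^-1] is 0 and the root says nothing about [u 0]. *)
have [N uN] : exists N, forall n, (N <= n)%N -> (0 < n)%N -> u n <= t^-1 ^+ n.
  move: tr; rewrite -ur limn_esup_inf => /ereal_inf_lt[_ [N _ <-]] Nt.
  exists N => n Nn n0; rewrite -[leLHS](powR_invn_expn _ n0) //.
  apply: lerXn2r; rewrite ?nnegrE ?powR_ge0 ?invr_ge0 ?(ltW t0) //.
  rewrite -lee_fin; apply: le_trans (ltW Nt).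
  by apply: ereal_sup_ubound; exists n.
pose q := s / t.
have q0 : 0 < q by rewrite divr_gt0.
have q1 : q < 1 by rewrite ltr_pdivrMr // mul1r.
(* The sum takes care of the indices up to [N], the summand 1 of the later ones. *)
exists (1 + \sum_(k < N.+1) u k * s ^+ k / q ^+ k), q; split=> // [|n].
  exact: ltW.
rewrite mulrDl mul1r.
have sum_ge0 : 0 <= \sum_(k < N.+1) u k * s ^+ k / q ^+ k.
  by apply: sumr_ge0 => k _; rewrite !mulr_ge0 ?invr_ge0 ?exprn_ge0 // ltW.
case: (ltnP n N.+1) => [nN|Nn].
  apply: ler_wpDl; first by rewrite exprn_ge0 // ltW.
  rewrite -ler_pdivrMr ?exprn_gt0 // (bigD1 (Ordinal nN)) //= lerDl.
  by apply: sumr_ge0 => k _; rewrite !mulr_ge0 ?invr_ge0 ?exprn_ge0 // ltW.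
apply: ler_wpDr; first by rewrite mulr_ge0 // exprn_ge0 // ltW.
rewrite /q expr_div_n mulrC ler_wpM2l ?exprn_ge0 ?(ltW s0) // -exprVn.
by apply: uN; [exact: ltnW|exact: leq_ltn_trans Nn].
Qed.

Lemma root_test_gt (R : realType) (u : nat -> R) (r : \bar R) (s : R) :
  (forall n, 0 <= u n) ->
  limn_esup (fun n => (u n `^ n%:R^-1)%:E) = (r^-1)%E ->
  (0 <= r)%E -> 0 < s -> (r < s%:E)%E ->
  forall N, exists2 n, (N <= n)%N & 1 <= u n * s ^+ n.
Proof.
move=> u0 ur r0 s0 rs N.
have : ((s^-1)%:E < r^-1)%E.
  case: r r0 rs {ur} => [r||] //; rewrite !(lee_fin, lte_fin) => r0 rs.
  rewrite inver; case: eqP => [_|/eqP rN0]; first by rewrite ltry.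
  by rewrite lte_fin ltf_pV2 ?posrE // lt0r rN0.
rewrite -ur limn_esup_inf => sr.
(* The tail starts at [N.+1] so that the index found is positive. *)
have : ((s^-1)%:E < esups (fun n => (u n `^ n%:R^-1)%:E) N.+1)%E.
  by apply: lt_le_trans sr _; apply: ereal_inf_lbound; exists N.+1.
move=> /ereal_sup_gt[_ [n /= Nn <-]]; rewrite lte_fin => sn.
exists n; first exact: ltnW.
have n0 : (0 < n)%N by exact: leq_ltn_trans Nn.
rewrite -[u n](powR_invn_expn _ n0) // -exprMn; apply: exprn_ege1.
by rewrite -ler_pdivrMr // div1r ltW.
Qed.

Lemma converges_totally_geometric (R : realType) (A : normedModType R)
    (g : nat -> A -> A) (L : set A) (C q : R) : 0 <= q -> q < 1 ->
  (forall n x, L x -> `|g n x| <= C * q ^+ n) -> converges_totally g L.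
Proof.
move=> q0 q1 gC; rewrite /converges_totally.
(* Over the empty set each supremum is -oo; the comparison of nonnegative series needs a point of
   [L]. *)
have [L0|/nonemptyPn L0] := pselect (L !=set0); last first.
  rewrite L0; apply: le_lt_trans (ltry 0); apply: npeseries_le0 => n _ _.
  by rewrite image_set0 ereal_sup0 leNye.
have C0 : 0 <= C.
  by have [x Lx] := L0; have := gC 0%N x Lx; rewrite expr0 mulr1; exact: le_trans.
apply: (@le_lt_trans _ _ (\sum_(0 <= n <oo) (C * q ^+ n)%:E)%E).
  apply: lee_nneseries => n _; last first.
    by apply: ge_ereal_sup => _ [x Lx <-]; rewrite lee_fin gC.
  move=> _; have [x Lx] := L0; apply: (@le_trans _ _ `|g n x|%:E); first by rewrite lee_fin.
  by apply: ereal_sup_ubound; exists x.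
have cv := @is_cvg_geometric_series R C q.
rewrite ger0_norm // in cv; have {}cv := cv q1.
rewrite (_ : (fun n => _) = EFin \o series (geometric C q)); last first.
  by apply/funext => n; rewrite /series /= sumEFin.
by rewrite EFin_lim // ltry.
Qed.

Lemma not_converges_at (R : realType) (A : normedModType R)
    (g : nat -> A -> A) (x : A) (e : R) : 0 < e ->
  (forall N, exists2 n, (N <= n)%N & e <= `|g n x|) -> ~ converges_at g x.
Proof.
move=> e0 ge /cvg_series_cvg_0 /cvgr0Pnorm_lt /(_ e e0)[N _ gN].
have [n Nn] := ge N.
by rewrite leNgt gN.
Qed.

(** * Moufang identities *)

(** The trailing 0 gives every summand a successor, so the cancellation rules need no variant for
    the last one. *)
Lemma zmod_init (V : zmodType) (x y : V) : x - y + 0 = 0 -> x = y.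
Proof. by rewrite addr0 => /subr0_eq. Qed.

(* Cancels opposite summands; the summands must match syntactically, including
   the scalars of [_ *: _]. *)
Ltac zmod_step :=
  match goal with
  | |- 0 = 0 => reflexivity
  | |- 0 + _ = 0 => rewrite add0r
  | |- - ?x + (?x + _) = 0 => rewrite addKr
  | |- ?x + (- ?x + _) = 0 => rewrite addNKr
  | |- - ?x + _ = 0 => rewrite (addrCA _ x)
  | |- ?x + _ = 0 => rewrite (addrCA _ (- x))
  end.
Ltac zmod :=
  apply: zmod_init; rewrite ?(opprD, opprK) -?addrA; repeat zmod_step.

Section alternative.
Context {R : realType} {A : normedModType R} (D : alt_star_algebra A).
Local Notation "x ** y" := (alt_mul D x y) (at level 40, left associativity).
Local Notation "x ^c" := (alt_conj D x).
Implicit Types x y z w : A.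

Lemma amulDl x y z : (x + y) ** z = x ** z + y ** z.
Proof. exact: linearDl. Qed.

Lemma amulDr x y z : z ** (x + y) = z ** x + z ** y.
Proof. exact: linearDr. Qed.

Lemma amulNl x y : (- x) ** y = - (x ** y).
Proof. exact: linearNl. Qed.

Lemma amulNr x y : x ** (- y) = - (x ** y).
Proof. exact: linearNr. Qed.

Lemma amulBl x y z : (x - y) ** z = x ** z - y ** z.
Proof. by rewrite amulDl amulNl. Qed.

Lemma amulBr x y z : z ** (x - y) = z ** x - z ** y.
Proof. by rewrite amulDr amulNr. Qed.

Lemma amul0l x : 0 ** x = 0.
Proof. exact: linear0l. Qed.

Lemma amul0r x : x ** 0 = 0.
Proof. exact: linear0r. Qed.

Lemma amulZl s x y : (s *: x) ** y = s *: (x ** y).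
Proof. exact: linearZl_LR. Qed.

Lemma amulZr s x y : x ** (s *: y) = s *: (x ** y).
Proof. exact: linearZr_LR. Qed.

Definition amulE := (amulDl, amulDr, amulNl, amulNr, amulZl, amulZr).

Definition associator x y z := x ** y ** z - x ** (y ** z).

Lemma associatorDl x y z w :
  associator (x + y) z w = associator x z w + associator y z w.
Proof. by rewrite /associator !amulE opprD addrACA. Qed.

Lemma associatorDm x y z w :
  associator x (y + z) w = associator x y w + associator x z w.
Proof. by rewrite /associator !amulE opprD addrACA. Qed.

Lemma associatorDr x y z w :
  associator x y (z + w) = associator x y z + associator x y w.
Proof. by rewrite /associator !amulE opprD addrACA. Qed.

(** Polarization: the left alternative law at [x + y] leaves only the two mixed associators. *)
Lemma associatorC12 x y z : associator x y z = - associator y x z.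
Proof.
have l0 u v : associator u u v = 0 by rewrite /associator alt_left subrr.
apply/eqP; rewrite -addr_eq0.
by have := l0 (x + y) z; rewrite associatorDl !associatorDm !l0 addr0 add0r => ->.
Qed.

Lemma associatorC23 x y z : associator x y z = - associator x z y.
Proof.
have r0 u v : associator u v v = 0 by rewrite /associator alt_right subrr.
apply/eqP; rewrite -addr_eq0.
by have := r0 x (y + z); rewrite associatorDm !associatorDr !r0 addr0 add0r => ->.
Qed.

Lemma associator_cycle x y z : associator x y z = associator y z x.
Proof. by rewrite associatorC12 associatorC23 opprK. Qed.

Lemma flexible x y : x ** y ** x = x ** (y ** x).
Proof.
apply/eqP; rewrite -subr_eq0 -/(associator x y x) associatorC12.
by rewrite /associator alt_right subrr oppr0.
Qed.

Lemma teichmuller w x y z :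
  associator (w ** x) y z - associator w (x ** y) z + associator w x (y ** z) =
  w ** associator x y z + associator w x y ** z.
Proof.
rewrite /associator !amulE; zmod.
Qed.

Lemma alt_right_lin x y z : z ** (x ** y) + z ** (y ** x) = z ** x ** y + z ** y ** x.
Proof.
have := associatorC23 z x y; rewrite /associator opprB => /eqP.
by rewrite subr_eq -addrA [- _ + _]addrC addrA eq_sym subr_eq addrC => /eqP.
Qed.

(** The linearized right alternative law for the pairs [x ** y + y ** x, x] and [x ** x, y], reduced
    by the one for [x, y], yields twice the identity. *)
Lemma right_moufang x y z : z ** (x ** y ** x) = z ** x ** y ** x.
Proof.
have e : z ** (x ** y ** x) *+ 2 = z ** x ** y ** x *+ 2.
  have := alt_right_lin (x ** y + y ** x) x z.
  have := alt_right_lin (x ** x) y z.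
  have := congr1 (fun w => w ** x) (alt_right_lin x y z).
  have := alt_right_lin x y (z ** x).
  rewrite !amulDl !amulDr -!flexible !alt_left !alt_right => e1 e2 e3 e4.
  rewrite amulDl e1 e2 in e4.
  transitivity (z ** (x ** y ** x) + z ** (y ** (x ** x)) +
      (z ** (x ** (x ** y)) + z ** (x ** y ** x))
    - (z ** (x ** (x ** y)) + z ** (y ** (x ** x)))).
    by rewrite mulr2n; zmod.
  by rewrite e4 e3 mulr2n; zmod.
move/eqP: e; rewrite -subr_eq0 -mulrnBl -scaler_nat scaler_eq0 pnatr_eq0 /=.
by rewrite subr_eq0 => /eqP.
Qed.

Lemma middle_moufang x y z : (z ** x) ** (y ** z) = (z ** (x ** y)) ** z.
Proof.
(* This is the right Moufang identity in terms of associators. It cancels two terms of the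
   Teichmueller identity for [y, z, x, z], and flexibility removes a third. *)
have g : associator y z (x ** z) = - associator (y ** z) x z.
  by rewrite /associator -right_moufang flexible opprB.
have e : associator (z ** x) y z = associator z x y ** z.
  have := teichmuller y z x z; rewrite g.
  have -> : associator z x z = 0 by rewrite /associator flexible subrr.
  rewrite amul0r add0r (associator_cycle y z x) addrAC subrr add0r => <-.
  by rewrite -associatorC12.
have -> : z ** x ** (y ** z) = z ** x ** y ** z - associator (z ** x) y z.
  by rewrite /associator subKr.
by rewrite e /associator amulBl subKr.
Qed.

End alternative.

(** * Slices of the quadratic cone *)

Section slices.
Context {R : realType} {A : normedModType R} (D : alt_star_algebra A).
Local Notation "x ** y" := (alt_mul D x y) (at level 40, left associativity).
Local Notation "x ^c" := (alt_conj D x).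
Implicit Types (x y z w I J : A) (c d : R[i]).

Lemma conj_one : (alt_one D)^c = alt_one D.
Proof.
have := alt_conjM D (alt_one D)^c (alt_one D).
by rewrite alt_mul1r alt_conjK alt_mul1r.
Qed.

Lemma conj_areal (s : R) : (areal D s)^c = areal D s.
Proof. by rewrite /areal linearZ /= conj_one. Qed.

Lemma areal_mul (s : R) x : areal D s ** x = s *: x.
Proof. by rewrite /areal amulZl alt_mul1l. Qed.

Lemma mul_areal (s : R) x : x ** areal D s = s *: x.
Proof. by rewrite /areal amulZr alt_mul1r. Qed.

Lemma areal_inj : injective (areal D).
Proof.
move=> s t /eqP; rewrite -subr_eq0 /areal -scalerBl scaler_eq0.
by rewrite (negbTE (alt_one_neq0 D)) orbF subr_eq0 => /eqP.
Qed.

Lemma unit_not_real J s : imag_units D J -> J <> areal D s.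
Proof.
move=> [_ JJ] Js; move: JJ; rewrite Js areal_mul /areal scalerA -scaleN1r.
by move=> /areal_inj; nra.
Qed.

(** With trace [t] and norm [n], the equation [J (t - J) = n] and [J^2 = -1] give [t J = n - 1]; a
    nonzero [t] would make [J] real. *)
Lemma unit_conj J : imag_units D J -> J^c = - J.
Proof.
move=> uJ; have [QJ JJ] := uJ.
case: QJ => [[s _ /esym /unit_not_real -/(_ uJ) //]|[t [n [Jt Jn _]]]].
have Jc : J^c = areal D t - J by rewrite -Jt /atr addrC addKr.
have tJ : t *: J = areal D (n - 1).
  move: Jn; rewrite /anm Jc amulBr mul_areal JJ => /eqP.
  by rewrite subr_eq => /eqP ->; rewrite /areal scalerBl scale1r.
have [t0|t0] := eqVneq t 0; first by rewrite Jc t0 /areal scale0r sub0r.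
case: (@unit_not_real J (t^-1 * (n - 1)) uJ).
by rewrite /areal -scalerA -/(areal D _) -tJ scalerA mulVf // scale1r.
Qed.

Lemma unit_mulK J x : imag_units D J -> J ** (J ** x) = - x.
Proof. by move=> [_ JJ]; rewrite -alt_left JJ amulNl alt_mul1l. Qed.

Lemma mul_unitK J x : imag_units D J -> x ** J ** J = - x.
Proof. by move=> [_ JJ]; rewrite alt_right JJ amulNr alt_mul1r. Qed.

Definition slice_emb J c : A := areal D (Re c) + Im c *: J.

(** Left multiplications by elements of one slice compose as in an associative algebra, because left
    alternativity gives [J (J x) = - x]. *)
Lemma slice_embM_act J c d x : imag_units D J ->
  slice_emb J c ** (slice_emb J d ** x) = slice_emb J (c * d) ** x.
Proof.
move=> uJ; case: c d => [a b] [a' b']; rewrite /slice_emb /=.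
rewrite !(amulDl, amulDr) !areal_mul !(amulZl, amulZr) unit_mulK //.
rewrite !scalerN !scalerA.
by rewrite [b' * b]mulrC scalerBl scalerDl; zmod.
Qed.

Lemma slice_embM_ract J c d x : imag_units D J ->
  x ** slice_emb J c ** slice_emb J d = x ** slice_emb J (c * d).
Proof.
move=> uJ; case: c d => [a b] [a' b']; rewrite /slice_emb /=.
rewrite !(amulDl, amulDr) !mul_areal !(amulZl, amulZr) mul_unitK //.
rewrite !scalerN !scalerA scalerBl scalerDl.
by rewrite [a' * a]mulrC [a' * b]mulrC; zmod.
Qed.

Lemma slice_embM J c d : imag_units D J ->
  slice_emb J c ** slice_emb J d = slice_emb J (c * d).
Proof.
by move=> uJ; have := slice_embM_act c d (alt_one D) uJ; rewrite !alt_mul1r.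
Qed.

Lemma slice_emb_real J (s : R) : slice_emb J s%:C%C = areal D s.
Proof. by rewrite /slice_emb /= scale0r addr0. Qed.

Lemma slice_embD J c d : slice_emb J (c + d) = slice_emb J c + slice_emb J d.
Proof.
case: c d => [a b] [a' b']; rewrite /slice_emb /areal /=.
by rewrite !scalerDl addrACA.
Qed.

Lemma slice_embN J c : slice_emb J (- c) = - slice_emb J c.
Proof. by case: c => [a b]; rewrite /slice_emb /areal /= !scaleNr -opprD. Qed.

Lemma slice_embB J c d : slice_emb J (c - d) = slice_emb J c - slice_emb J d.
Proof. by rewrite slice_embD slice_embN. Qed.

Lemma slice_emb_conjN J c : slice_emb (- J) c = slice_emb J (conjc c).
Proof. by case: c => [a b]; rewrite /slice_emb /= scalerN scaleNr. Qed.

Lemma slice_emb_conj J c : imag_units D J ->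
  (slice_emb J c)^c = slice_emb J (conjc c).
Proof.
move=> uJ; case: c => [a b]; rewrite /slice_emb /= linearD /= conj_areal linearZ /=.
by rewrite unit_conj // scalerN scaleNr.
Qed.

Lemma normc_sqrE c : normc c ^+ 2 = Re c ^+ 2 + Im c ^+ 2.
Proof. by case: c => a b /=; rewrite sqr_sqrtr // addr_ge0 ?sqr_ge0. Qed.

Lemma normc_ge0 c : 0 <= normc c.
Proof. by case: c => a b /=; exact: sqrtr_ge0. Qed.

Lemma normc_eq0 c : (normc c == 0) = (c == 0).
Proof.
apply/eqP/eqP => [/ComplexField.Normc.eq0_normc //|->].
exact: ComplexField.Normc.normc0.
Qed.

Lemma normcX c n : normc (c ^+ n) = normc c ^+ n.
Proof.
elim: n => [|n IH]; first by rewrite !expr0 ComplexField.Normc.normc1.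
by rewrite !exprS ComplexField.Normc.normcM IH.
Qed.

Lemma mul_conjc c : c * conjc c = ((normc c ^+ 2)%:C)%C.
Proof.
rewrite normc_sqrE; case: c => a b /=; apply/eqP; rewrite eq_complex /=.
by apply/andP; split; apply/eqP; ring.
Qed.

Lemma normc_conj c : normc (conjc c) = normc c.
Proof. by case: c => a b /=; rewrite sqrrN. Qed.

Lemma slice_emb_anm J c : imag_units D J ->
  anm D (slice_emb J c) = areal D (normc c ^+ 2).
Proof.
by move=> uJ; rewrite /anm slice_emb_conj // slice_embM // mul_conjc slice_emb_real.
Qed.

Lemma slice_emb_atr J c : imag_units D J ->
  atr D (slice_emb J c) = areal D (Re c *+ 2).
Proof.
move=> uJ; rewrite /atr slice_emb_conj // -slice_embD.
by case: c => a b; rewrite /slice_emb /= subrr scale0r addr0 mulr2n.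
Qed.

Lemma slice_emb_cone J c : imag_units D J -> quadratic_cone D (slice_emb J c).
Proof.
move=> uJ; have [b0|b0] := eqVneq (Im c) 0.
  by left; exists (Re c) => //; rewrite /slice_emb b0 scale0r addr0.
right; exists (Re c *+ 2), (normc c ^+ 2).
rewrite slice_emb_anm // slice_emb_atr //; split=> //.
rewrite normc_sqrE.
by have : 0 < Im c ^+ 2 by [rewrite exprn_even_gt0]; nra.
Qed.

Lemma cone_slice_emb x : imag_units D !=set0 -> quadratic_cone D x ->
  exists J c, [/\ imag_units D J, 0 <= Im c & x = slice_emb J c].
Proof.
move=> [J0 uJ0] [[s _ <-]|[t [n [xt xn tn]]]].
  by exists J0, s%:C%C; split=> //; rewrite slice_emb_real.
(* Completing the square: [b] is the length of the imaginary part of [x], and [J] its direction. *)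
pose b := Num.sqrt (n - t ^+ 2 / 4).
have b2 : b ^+ 2 = n - t ^+ 2 / 4 by rewrite sqr_sqrtr //; lra.
have b0 : 0 < b by rewrite sqrtr_gt0; lra.
pose J := b^-1 *: (x - areal D (t / 2)).
have xc : x^c = areal D t - x by rewrite -xt /atr addrC addKr.
have xx : x ** x = t *: x - areal D n.
  by rewrite -xn /anm xc amulBr mul_areal; zmod.
have JJ : J ** J = - alt_one D.
  rewrite /J amulZl amulZr amulBl !amulBr xx !areal_mul !mul_areal.
  rewrite (_ : _ - _ = - (b ^+ 2) *: alt_one D).
    by rewrite !scalerA -expr2 mulrN exprVn mulVf ?scaleN1r ?sqrf_eq0 ?gt_eqF.
  rewrite b2 /areal !scalerA.
  have -> : t *: x = (t / 2) *: x + (t / 2) *: x by rewrite -scalerDl -splitr.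
  have -> : - (n - t ^+ 2 / 4) = t / 2 * (t / 2) - n by lra.
  by rewrite scalerBl; zmod.
have Jc : J^c = - J.
  rewrite /J linearZ /= linearB /= conj_areal xc -[RHS]scalerN; congr (_ *: _).
  have -> : areal D t = areal D (t / 2) + areal D (t / 2).
    by rewrite /areal -scalerDl -splitr.
  by zmod.
exists J, (Complex (t / 2) b); split=> /=; [|exact: ltW|].
  split=> //; right; exists 0, 1; split; last by lra.
    by rewrite /atr Jc subrr /areal scale0r.
  by rewrite /anm Jc amulNr JJ opprK /areal scale1r.
by rewrite /slice_emb /J /= scalerA mulfV ?gt_eqF // scale1r addrC subrK.
Qed.

End slices.

(** * Terms of the power and spherical series *)

Section terms.
Context {R : realType} {A : normedModType R} (D : alt_star_algebra A).
Local Notation "x ** y" := (alt_mul D x y) (at level 40, left associativity).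
Local Notation "x ^c" := (alt_conj D x).
Implicit Types (x y z w I J : A) (c d : R[i]).

Lemma slice_emb_i I : slice_emb D I (Complex 0 1) = I.
Proof. by rewrite /slice_emb /= /areal scale0r add0r scale1r. Qed.

(** The complexification of the slice of [I] splits as two copies of the complex numbers through
    [p + i q] and [p - i q], and powers are computed in each copy. *)
Lemma acexp_slice I c1 c2 n : imag_units D I ->
  exists p q, [/\ acexp D (slice_emb D I c1, slice_emb D I c2) n =
                    (slice_emb D I p, slice_emb D I q),
    p + Complex 0 1 * q = (c1 + Complex 0 1 * c2) ^+ n &
    p - Complex 0 1 * q = (c1 - Complex 0 1 * c2) ^+ n].
Proof.
move=> uI; elim: n => [|n [p [q [IHe IHp IHm]]]].
  exists 1, 0; rewrite mulr0 addr0 subr0 !expr0; split=> //.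
  by rewrite /acexp /slice_emb /areal /= scale1r !scale0r !addr0.
exists (c1 * p - c2 * q), (c1 * q + c2 * p).
rewrite !exprS -IHp -IHm; split.
- rewrite /acexp iterS -/(acexp _ _ n) IHe /acmul /= !slice_embM //.
  by rewrite slice_embB slice_embD.
- case: c1 c2 p q {IHe IHp IHm} => [a1 b1] [a2 b2] [a3 b3] [a4 b4].
  by apply/eqP; rewrite eq_complex /=; apply/andP; split; apply/eqP; ring.
- case: c1 c2 p q {IHe IHp IHm} => [a1 b1] [a2 b2] [a3 b3] [a4 b4].
  by apply/eqP; rewrite eq_complex /=; apply/andP; split; apply/eqP; ring.
Qed.

(** This is the representation formula of slice functions multiplied by [2 J]. The factor [J] turns
    the products of [J] and [I] in its coefficients into sums, so no association of [J], [I] and the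
    values has to be justified. *)
Lemma power_termE I J c d n a : imag_units D I -> imag_units D J ->
  2 *: (J ** power_term D (slice_emb D I d) n a (slice_emb D J c)) =
  (I + J) ** (slice_emb D I ((c - d) ^+ n) ** a) +
  (J - I) ** (slice_emb D I ((conjc c - d) ^+ n) ** a).
Proof.
move=> uI uJ; case: c => s t.
rewrite /power_term {2}/slice_emb slice_funE //=; last exact: power_stemP.
rewrite /power_stem.
have -> : ac_of_C D (Complex s t) - ac_of_A (slice_emb D I d) =
    (slice_emb D I (s%:C%C - d), slice_emb D I t%:C%C).
  by rewrite slice_embB !slice_emb_real -[areal D t in RHS]subr0.
have [p [q [-> pq mq]]] := acexp_slice (s%:C%C - d) t%:C%C n uI.
have -> : Complex s t - d = s%:C%C - d + Complex 0 1 * t%:C%C.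
  case: d {pq mq} => a1 b1.
  by apply/eqP; rewrite eq_complex /=; apply/andP; split; apply/eqP; ring.
have -> : Complex s (- t) - d = s%:C%C - d - Complex 0 1 * t%:C%C.
  case: d {pq mq} => a1 b1.
  by apply/eqP; rewrite eq_complex /=; apply/andP; split; apply/eqP; ring.
rewrite -pq -mq slice_embD slice_embB -slice_embM // slice_emb_i.
rewrite /acmul /= !amul0r subr0 add0r.
have eI : (I ** slice_emb D I q) ** a = I ** (slice_emb D I q ** a).
  by rewrite -{1 3}(slice_emb_i I) slice_embM // slice_embM_act.
move: (slice_emb D I p) (slice_emb D I q) eI => P Q eI.
rewrite !(amulDl, amulDr, amulNl, amulNr) eI !unit_mulK //.
by rewrite scaler_nat mulr2n; zmod.
Qed.

Lemma acmul_C c d : acmul D (ac_of_C D c) (ac_of_C D d) = ac_of_C D (c * d).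
Proof.
case: c d => [a b] [a' b']; rewrite /acmul /ac_of_C /= !areal_mul.
by rewrite /areal !scalerA -scalerBl -scalerDl.
Qed.

Lemma acexp_C c n : acexp D (ac_of_C D c) n = ac_of_C D (c ^+ n).
Proof.
elim: n => [|n IH]; first by rewrite expr0 /ac_of_C /areal /= scale1r scale0r.
by rewrite exprS -acmul_C -IH.
Qed.

Lemma DeltaE I J c d : imag_units D I -> imag_units D J ->
  Delta D (slice_emb D I d) (slice_emb D J c) =
  slice_emb D J ((c - d) * (c - conjc d)).
Proof.
move=> uI uJ; rewrite /Delta slice_emb_atr // slice_emb_anm // slice_embM //.
rewrite -!(slice_emb_real D J) slice_embM // -slice_embB -slice_embD normc_sqrE.
congr (slice_emb _ _ _); case: c d => [a b] [a' b'].
by apply/eqP; rewrite eq_complex /= mulr2n; apply/andP; split; apply/eqP; ring.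
Qed.

(** [Delta] has real coefficients, so its powers at a complex point are complex scalars in the
    complexification; they commute with [y] and can be pulled out to the left as elements of the
    slice of [J]. *)
Lemma spherical_termE I J c d n a : imag_units D I -> imag_units D J ->
  spherical_term D (slice_emb D I d) n a (slice_emb D J c) =
  slice_emb D J (((c - d) * (c - conjc d)) ^+ n./2) **
    (if odd n then (slice_emb D J c - slice_emb D I d) ** a else a).
Proof.
move=> uI uJ; set delta := (c - d) * (c - conjc d).
have acD : acDelta D (slice_emb D I d) (ac_of_C D c) = ac_of_C D delta.
  rewrite /acDelta slice_emb_atr // slice_emb_anm //.
  have acR s : ac_of_A (areal D s) = ac_of_C D s%:C%C.
    by rewrite /ac_of_C /ac_of_A /areal /= scale0r.
  rewrite !acR !acmul_C normc_sqrE /delta; case: (c) (d) => [a1 b1] [a2 b2].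
  rewrite /ac_of_C /=; congr (_, _); rewrite /= /areal -?scalerBl -?scalerDl.
    by congr (_ *: _); rewrite mulr2n; ring.
  by congr (_ *: _); rewrite mulr2n; ring.
rewrite /spherical_term {2}/slice_emb.
rewrite slice_funE //=; last exact: spherical_stemP.
have -> : Complex (Re c) (Im c) = c by case: (c).
rewrite /spherical_stem /spherical_poly acD acexp_C.
move: (slice_emb D I d) (delta ^+ _) => y p.
case: odd; rewrite /acmul /= !areal_mul ?mul_areal; last first.
  by rewrite !scaler0 subr0 add0r /slice_emb amulDl areal_mul amulZr amulZl.
rewrite !amul0r !subr0 add0r /slice_emb.
rewrite !(amulDl, amulDr, amulNl, amulNr, areal_mul) !(amulZl, amulZr) !(scalerDr, scalerN).
rewrite !(amulDl, amulDr, amulNl, amulNr, areal_mul) !(amulZl, amulZr) !(scalerDr, scalerN).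
rewrite unit_mulK // ?scalerN !scalerA !alt_mul1l [Im c * Im p]mulrC.
by zmod.
Qed.

End terms.

(** * Estimates for the power series *)

Section bounds.
Context {R : realType} {A : normedModType R} (D : alt_star_algebra A).
Context (normA : norm_compatible D) (units : imag_units D !=set0).
Context (C : R) (C_gt0 : 0 < C).
Local Notation "x ** y" := (alt_mul D x y) (at level 40, left associativity).
Local Notation "x ^c" := (alt_conj D x).
Context (mul_le : forall x y, `|x ** y| <= C * `|x| * `|y|).
Implicit Types (x y z w I J K : A) (c d : R[i]).

Lemma norm_slice_emb J c : imag_units D J -> `|slice_emb D J c| = normc c.
Proof.
move=> uJ; rewrite (normA (slice_emb_cone c uJ) (slice_emb_anm c uJ)).
by rewrite sqrtr_sqr ger0_norm // normc_ge0.
Qed.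

Lemma norm_areal s : `|areal D s| = `|s|.
Proof.
have [J uJ] := units; rewrite -(slice_emb_real D J) norm_slice_emb //=.
by rewrite expr0n addr0 sqrtr_sqr.
Qed.

Lemma norm_unit J : imag_units D J -> `|J| = 1.
Proof.
move=> uJ; rewrite -(slice_emb_i D J) norm_slice_emb //=.
by rewrite expr0n expr1n add0r sqrtr1.
Qed.

Lemma conj_mulK x z : quadratic_cone D x -> x^c ** (x ** z) = `|x| ^+ 2 *: z.
Proof.
move=> /(cone_slice_emb units)[J [c [uJ _ ->]]].
rewrite norm_slice_emb // slice_emb_conj // slice_embM_act // mulrC mul_conjc.
by rewrite slice_emb_real areal_mul.
Qed.

Lemma mulK_conj x z : quadratic_cone D x -> x ** (x^c ** z) = `|x| ^+ 2 *: z.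
Proof.
move=> /(cone_slice_emb units)[J [c [uJ _ ->]]].
rewrite norm_slice_emb // slice_emb_conj // slice_embM_act // mul_conjc.
by rewrite slice_emb_real areal_mul.
Qed.

Lemma mul_conjK x z : quadratic_cone D x -> z ** x ** x^c = `|x| ^+ 2 *: z.
Proof.
move=> /(cone_slice_emb units)[J [c [uJ _ ->]]].
rewrite norm_slice_emb // slice_emb_conj // slice_embM_ract // mul_conjc.
by rewrite slice_emb_real mul_areal.
Qed.

Lemma norm_conj x : quadratic_cone D x -> `|x^c| = `|x|.
Proof.
move=> /(cone_slice_emb units)[J [c [uJ _ ->]]].
by rewrite slice_emb_conj // !norm_slice_emb // normc_conj.
Qed.

Lemma cone_conj x : quadratic_cone D x -> quadratic_cone D x^c.
Proof.
move=> /(cone_slice_emb units)[J [c [uJ _ ->]]].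
by rewrite slice_emb_conj //; exact: slice_emb_cone.
Qed.

(** Multiplying [x ** z] by [x^c] returns [|x|^2 z], and this product costs at most [C |x|]. *)
Lemma cone_mul_ge x z : quadratic_cone D x -> `|x| * `|z| <= C * `|x ** z|.
Proof.
move=> Qx; have [->|x0] := eqVneq x 0.
  by rewrite normr0 mul0r mulr_ge0 // ltW.
rewrite -(ler_pM2l (_ : 0 < `|x|)) ?normr_gt0 // mulrA -expr2.
have := mul_le x^c (x ** z); rewrite conj_mulK // normrZ norm_conj //.
rewrite ger0_norm ?sqr_ge0 // => h; apply: le_trans h _.
by rewrite mulrA [_ * C]mulrC.
Qed.

Lemma mul_cone_ge x z : quadratic_cone D x -> `|z| * `|x| <= C * `|z ** x|.
Proof.
move=> Qx; have [->|x0] := eqVneq x 0.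
  by rewrite normr0 mulr0 mulr_ge0 // ltW.
rewrite -(ler_pM2r (_ : 0 < `|x|)) ?normr_gt0 // -mulrA -expr2.
have := mul_le (z ** x) x^c; rewrite mul_conjK // normrZ norm_conj //.
by rewrite ger0_norm ?sqr_ge0 // mulrC.
Qed.

(* An element of the cone is invertible, and the middle Moufang identity gives
   [K (u a) = a ((a^-1 K) u) a]. *)
Lemma mul_mul_cone_ge K u a : quadratic_cone D u -> quadratic_cone D a ->
  `|K| * `|u| * `|a| <= C ^+ 4 * `|K ** (u ** a)|.
Proof.
move=> Qu Qa; have [->|a0] := eqVneq a 0.
  by rewrite normr0 mulr0 mulr_ge0 // exprn_ge0 // ltW.
have na : 0 < `|a| by rewrite normr_gt0.
(* The inverse of [a] is the conjugate divided by [|a|^2]; below, the four factors around [K] are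
   stripped one by one, each for a factor [C]. *)
have e : `|a| ^+ 2 * `|K ** (u ** a)| = `|a ** (a^c ** K ** u) ** a|.
  by rewrite -middle_moufang mulK_conj // amulZl normrZ ger0_norm ?sqr_ge0 //.
have h1 := mul_cone_ge (a ** (a^c ** K ** u)) Qa.
have h2 := cone_mul_ge (a^c ** K ** u) Qa.
have h3 := mul_cone_ge (a^c ** K) Qu.
have h4 := cone_mul_ge K (cone_conj Qa).
rewrite norm_conj // in h4; rewrite -e in h1.
rewrite -(ler_pM2l (_ : 0 < `|a| ^+ 2)) ?exprn_gt0 //.
apply: (@le_trans _ _ (C * `|a^c ** K| * `|u| * `|a| * `|a|)).
  rewrite [leLHS](_ : _ = `|a| * `|K| * `|u| * `|a| * `|a|); last by ring.
  by rewrite !ler_wpM2r.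
apply: (@le_trans _ _ (C ^+ 2 * `|a^c ** K ** u| * `|a| * `|a|)).
  rewrite [leRHS](_ : _ = C * (C * `|a^c ** K ** u|) * `|a| * `|a|); last by ring.
  by rewrite !ler_wpM2r // -mulrA ler_pM2l.
apply: (@le_trans _ _ (C ^+ 3 * `|a ** (a^c ** K ** u)| * `|a|)).
  rewrite [leLHS](_ : _ = C ^+ 2 * (`|a| * `|a^c ** K ** u|) * `|a|); last by ring.
  rewrite [leRHS](_ : _ = C ^+ 2 * (C * `|a ** (a^c ** K ** u)|) * `|a|); last by ring.
  by rewrite ler_wpM2r // ler_pM2l // exprn_gt0.
rewrite [leRHS](_ : _ = C ^+ 3 * (C * (`|a| ^+ 2 * `|K ** (u ** a)|))); last by ring.
by rewrite -mulrA ler_pM2l // exprn_gt0.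
Qed.

Lemma norm_slice_mul_le I c n a : imag_units D I ->
  `|slice_emb D I (c ^+ n) ** a| <= C * normc c ^+ n * `|a|.
Proof. by move=> uI; rewrite -normcX -(norm_slice_emb _ uI); exact: mul_le. Qed.

Lemma unit_mul_le I K x b : imag_units D I -> `|K| <= 2 -> `|x| <= C * b ->
  `|K ** x| <= 2 * C ^+ 2 * b.
Proof.
move=> uI K2 xb; apply: le_trans (mul_le _ _) _.
rewrite [leRHS](_ : _ = C * 2 * (C * b)); last by ring.
by rewrite ler_pM // ?mulr_ge0 // ?ler_pM2l // ltW.
Qed.

Lemma norm_unitD I J : imag_units D I -> imag_units D J -> `|I + J| <= 2.
Proof.
by move=> uI uJ; apply: le_trans (ler_normD _ _) _; rewrite !norm_unit.
Qed.

Lemma norm_unitB I J : imag_units D I -> imag_units D J -> `|I - J| <= 2.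
Proof.
by move=> uI uJ; apply: le_trans (ler_normB _ _) _; rewrite !norm_unit.
Qed.

Lemma power_term_le I J c d s n a : imag_units D I -> imag_units D J ->
  normc (c - d) <= s -> I = J \/ normc (conjc c - d) <= s ->
  `|power_term D (slice_emb D I d) n a (slice_emb D J c)| <=
  2 * C ^+ 3 * s ^+ n * `|a|.
Proof.
move=> uI uJ cs IJ; set T := power_term _ _ _ _ _.
have bnd K c' : `|K| <= 2 -> normc c' <= s ->
    `|K ** (slice_emb D I (c' ^+ n) ** a)| <= 2 * C ^+ 2 * (s ^+ n * `|a|).
  move=> K2 c's; apply: (@unit_mul_le I) => //.
  apply: le_trans (norm_slice_mul_le _ _ _ uI) _.
  rewrite -mulrA ler_pM2l // ler_wpM2r // lerXn2r ?nnegrE ?normc_ge0 //.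
  by rewrite (le_trans _ cs) ?normc_ge0.
have JT : `|J ** T| <= 2 * C ^+ 2 * (s ^+ n * `|a|).
  rewrite -(ler_pM2l (_ : 0 < 2)) // -[X in X * `|_| <= _](@ger0_norm _ 2) //.
  rewrite -normrZ power_termE // [leRHS]mulrDl mul1r.
  apply: le_trans (ler_normD _ _) _; apply: lerD.
    by apply: bnd => //; exact: norm_unitD.
  case: IJ => [->|c's]; last by apply: bnd => //; exact: norm_unitB.
  rewrite subrr amul0l normr0 !mulr_ge0 // ?exprn_ge0 // ?(ltW C_gt0) //.
  by rewrite (le_trans _ cs) ?normc_ge0.
(* [T = - J (J T)], so removing [J] costs one more factor [C]. *)
rewrite -[T]opprK -(unit_mulK T uJ) normrN; apply: le_trans (mul_le _ _) _.
rewrite (norm_unit uJ) mulr1 [leRHS](_ : _ = C * (2 * C ^+ 2 * (s ^+ n * `|a|))).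
  by rewrite ler_pM2l.
by ring.
Qed.

(** In [power_termE] the first summand eventually dominates: the second one vanishes or, up to a
    constant, is smaller by the n-th power of a quotient below 1. *)
Lemma power_term_ge I J c d : imag_units D I -> imag_units D J -> I + J != 0 ->
  0 < normc (c - d) -> I = J \/ normc (conjc c - d) < normc (c - d) ->
  exists2 e : R, 0 < e & exists N, forall n a, (N <= n)%N ->
    quadratic_cone D a ->
    e * (`|a| * normc (c - d) ^+ n) <=
    `|power_term D (slice_emb D I d) n a (slice_emb D J c)|.
Proof.
move=> uI uJ IJ0 s0 IJ; set s := normc (c - d).
have C4 : 0 < C ^+ 4 by rewrite exprn_gt0.
(* [k] is the constant that [mul_mul_cone_ge] provides for the factor [I + J]. *)
have [k kE k0] : exists2 k : R, k * C ^+ 4 = `|I + J| & 0 < k.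
  by exists (`|I + J| / C ^+ 4); rewrite ?divfK ?gt_eqF // divr_gt0 ?normr_gt0.
(* A first summand of weight [k] and a second of weight at most [k / 2] leave [k / 2] for
   [2 * |J ** T|]; removing [J] divides by [C]. *)
exists (k / (4 * C)); first by rewrite divr_gt0 // mulr_gt0.
have [N small] : exists N, forall n a, (N <= n)%N ->
    `|(J - I) ** (slice_emb D I ((conjc c - d) ^+ n) ** a)| <=
    k / 2 * (`|a| * s ^+ n).
  case: IJ => [->|vs].
    exists 0%N => n a _; rewrite subrr amul0l normr0.
    by rewrite !mulr_ge0 ?exprn_ge0 ?invr_ge0 ?(ltW k0) ?(ltW s0).
  set v := normc (conjc c - d) in vs *.
  have v0 : 0 <= v by exact: normc_ge0.
  have : (v / s) ^+ n @[n --> \oo] --> (0 : R).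
    by apply: cvg_expr; rewrite ger0_norm ?divr_ge0 ?(ltW s0) // ltr_pdivrMr // mul1r.
  (* The threshold turns the bound [2 * C ^+ 2 * v ^+ n] into [k / 2 * s ^+ n]. *)
  have e0 : 0 < k / (4 * C ^+ 2) by rewrite divr_gt0 // mulr_gt0 // exprn_gt0.
  move=> /cvgr0Pnorm_lt/(_ _ e0)[N _ hN]; exists N => n a Nn.
  have := hN n Nn; rewrite /= ger0_norm ?exprn_ge0 ?divr_ge0 ?(ltW s0) //.
  rewrite expr_div_n ltr_pdivrMr ?exprn_gt0 // => vn.
  apply: le_trans (@unit_mul_le I _ _ (v ^+ n * `|a|) uI (norm_unitB uJ uI) _) _.
    by rewrite mulrA; exact: norm_slice_mul_le.
  rewrite [leRHS](_ : _ = 2 * C ^+ 2 * (k / (4 * C ^+ 2) * s ^+ n * `|a|)).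
    by rewrite ler_pM2l ?mulr_gt0 ?exprn_gt0 // ler_wpM2r // ltW.
  by field; rewrite gt_eqF.
exists N => n a Nn Qa; set T := power_term _ _ _ _ _.
have big : k * (`|a| * s ^+ n) <= `|(I + J) ** (slice_emb D I ((c - d) ^+ n) ** a)|.
  rewrite -(ler_pM2l C4) mulrA [_ * k]mulrC kE [`|a| * _]mulrC mulrA.
  rewrite /s -normcX -(norm_slice_emb _ uI).
  by apply: mul_mul_cone_ge => //; exact: slice_emb_cone.
have JT : k / 2 * (`|a| * s ^+ n) <= 2 * `|J ** T|.
  rewrite -[X in X * `|_|](@ger0_norm _ 2) // -normrZ power_termE //.
  have := small n a Nn; set x := _ ** _ in big *; set y := _ ** _ => yk.
  have := lerB_normD x y; lra.
have := mul_le J T; rewrite (norm_unit uJ) mulr1 => JT'.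
rewrite [leLHS](_ : _ = (k / 2 * (`|a| * s ^+ n)) / (2 * C)); last first.
  by field; rewrite gt_eqF.
rewrite ler_pdivrMr ?mulr_gt0 //; apply: le_trans JT _.
rewrite [leRHS](_ : _ = 2 * (C * `|T|)); last by ring.
by rewrite ler_pM2l.
Qed.

End bounds.

(** * The distance sigma *)

Lemma closure_affine (R : realType) (A : normedModType R) (S : set A) (x v : A) :
  (forall e : R, 0 < e -> e < 1 -> S (x + e *: v)) -> closure S x.
Proof.
move=> Sv B Bx.
have : (x + e *: v) @[e --> (0 : R)^'+] --> x.
  apply: cvg_at_right_filter; rewrite -[X in _ --> X]addr0 -(scale0r v).
  by apply: cvgD; [exact: cvg_cst|apply: cvgZr_tmp; exact: cvg_id].
move=> /(_ B Bx) nB; near (0 : R)^'+ => e.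
exists (x + e *: v); split; last by near: e.
by apply: Sv; near: e; [exact: nbhs_right_gt|exact: nbhs_right_lt].
Unshelve. all: by end_near. Qed.

(** The root test needs a positive radius, whereas the distance bound [s] may be 0. *)
Lemma ereal_lt_pos_ge (R : realType) (s : R) (r : \bar R) :
  (0 < r)%E -> (s%:E < r)%E -> exists t : R, [/\ 0 < t, (t%:E < r)%E & s <= t].
Proof.
case: r => [r||] //; rewrite ?lte_fin => r0 sr.
  exists (Num.max s (r / 2)); rewrite lte_fin le_max lexx lt_max gt_max sr.
  by split=> //; [apply/orP; right|]; lra.
by exists (Num.max s 1); rewrite le_max lexx lt_max ltr01 orbT ltry.
Qed.

(** The point [s + i t] moves towards the real point [s'], the foot of [s' + i t'], which lies
    across the real axis. *)
Lemma sqr_dist_contract (R : realFieldType) (e s t s' t' : R) :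
  0 < e -> e < 1 -> 0 < t -> t' < 0 ->
  (s + e * (s' - s) - s') ^+ 2 + ((1 - e) * t - t') ^+ 2 <
  (s - s') ^+ 2 + (t - t') ^+ 2.
Proof.
move=> e0 e1 t0 t'0.
have -> : s + e * (s' - s) - s' = (1 - e) * (s - s') by ring.
apply: ler_ltD.
  by rewrite exprMn ler_piMl ?sqr_ge0 // exprn_ile1; lra.
by rewrite ltrXn2r // ?nnegrE; nra.
Qed.

Section distances.
Context {R : realType} {A : normedModType R} (D : alt_star_algebra A).
Context (normA : norm_compatible D) (units : imag_units D !=set0).
Local Notation "x ** y" := (alt_mul D x y) (at level 40, left associativity).
Implicit Types (x y z w I J K : A) (c d : R[i]).

Lemma unit_opp J : imag_units D J -> imag_units D (- J).
Proof.
move=> uJ; split; last by rewrite amulNl amulNr opprK uJ.2.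
by rewrite -(slice_emb_i D J) -slice_embN; exact: slice_emb_cone.
Qed.

Lemma aRe_slice_emb J c : imag_units D J -> aRe D (slice_emb D J c) = areal D (Re c).
Proof.
move=> uJ; rewrite /aRe -/(atr D _) slice_emb_atr // /areal scalerA.
by rewrite -[Re c *+ 2]mulr_natl mulKf // pnatr_eq0.
Qed.

Lemma aIm_slice_emb J c : imag_units D J -> aIm D (slice_emb D J c) = Im c *: J.
Proof.
move=> uJ; rewrite /aIm slice_emb_conj // -slice_embB; case: c => s t /=.
rewrite /slice_emb /= subrr /areal scale0r add0r opprK scalerA.
by rewrite -mulr2n -[t *+ 2]mulr_natl mulKf // pnatr_eq0.
Qed.

Lemma Cslice_slice_emb J x : Cslice D J x <-> exists c, x = slice_emb D J c.
Proof.
split=> [[s [t ->]]|[c ->]]; first by exists (Complex s t).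
by exists (Re c), (Im c).
Qed.

Lemma sigma_dist_same K x y : imag_units D K -> Cslice D K x -> Cslice D K y ->
  sigma_dist D x y = `|x - y|.
Proof. by move=> uK Kx Ky; rewrite /sigma_dist asboolT //; exists K. Qed.

Lemma sigma_dist_other I J c d : imag_units D I -> imag_units D J ->
  (forall K, imag_units D K -> Cslice D K (slice_emb D I d) ->
     ~ Cslice D K (slice_emb D J c)) ->
  sigma_dist D (slice_emb D J c) (slice_emb D I d) =
  Num.sqrt ((Re c - Re d) ^+ 2 + (`|Im c| + `|Im d|) ^+ 2).
Proof.
move=> uI uJ noK; rewrite /sigma_dist asboolF; last first.
  by move=> [K [uK Ky]]; exact: noK Ky.
rewrite !aRe_slice_emb // !aIm_slice_emb // !normrZ (norm_unit normA uI) (norm_unit normA uJ).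
rewrite !mulr1.
by rewrite /areal -scalerBl -/(areal D _) norm_areal // real_normK // num_real.
Qed.

Lemma Im0_Cslice J K c : Im c = 0 -> Cslice D K (slice_emb D J c).
Proof.
by move=> c0; exists (Re c), 0; rewrite /slice_emb c0 !scale0r.
Qed.

Lemma double_unit_neq0 K : imag_units D K -> K + K != 0.
Proof.
move=> uK; rewrite -mulr2n -scaler_nat scaler_eq0 pnatr_eq0 /=.
by rewrite -normr_eq0 (norm_unit normA) // oner_eq0.
Qed.

(* The sign of [I] is chosen such that the conjugate of [c] is at least as close
   to [d] as [c]. *)
Lemma sigma_dist_cases x y : quadratic_cone D x -> quadratic_cone D y ->
  exists I J c d, [/\ imag_units D I, imag_units D J,
    x = slice_emb D J c & y = slice_emb D I d] /\
    [/\ sigma_dist D x y = normc (c - d), I + J != 0 &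
    I = J \/ [/\ 0 < Im c, Im d < 0 &
      forall K, imag_units D K -> Cslice D K y -> ~ Cslice D K x]].
Proof.
move=> Qx Qy.
have [[K [uK Ky Kx]]|noK] :=
    pselect (exists K, [/\ imag_units D K, Cslice D K y & Cslice D K x]).
  have /Cslice_slice_emb[c xc] := Kx; have /Cslice_slice_emb[d yd] := Ky.
  exists K, K, c, d; split=> //; split; [|exact: double_unit_neq0|by left].
  by rewrite (sigma_dist_same uK Kx Ky) xc yd -slice_embB (norm_slice_emb normA).
have {}noK K : imag_units D K -> Cslice D K y -> ~ Cslice D K x.
  by move=> uK Ky Kx; apply: noK; exists K.
have [J [c [uJ c0 xc]]] := cone_slice_emb units Qx.
have [I [d [uI d0 yd]]] := cone_slice_emb units Qy.
have {}c0 : 0 < Im c.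
  rewrite lt0r c0 andbT; apply/eqP => ci; apply: (noK I uI).
    by apply/Cslice_slice_emb; exists d.
  by rewrite xc; exact: Im0_Cslice.
have {}d0 : 0 < Im d.
  rewrite lt0r d0 andbT; apply/eqP => di; apply: (noK J uJ).
    by rewrite yd; exact: Im0_Cslice.
  by apply/Cslice_slice_emb; exists c.
(* Replacing [I, d] by [- I, conjc d] keeps [y] and turns the sum of the imaginary lengths into the
   imaginary part of a difference. *)
exists (- I), J, c, (conjc d); split.
  by split=> //; [exact: unit_opp|rewrite slice_emb_conjN conjcK].
split; last by right; split=> //; case: (d) d0 => s t /=; rewrite oppr_lt0.
  rewrite {1}xc yd sigma_dist_other -?yd -?xc // gtr0_norm // gtr0_norm //.
  by case: (c) (d) => [s t] [s' t'] /=; rewrite opprK.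
apply/eqP => /eqP; rewrite addrC subr_eq0 => /eqP JI; apply: (noK I uI).
  by apply/Cslice_slice_emb; exists d.
by apply/Cslice_slice_emb; exists c; rewrite -JI.
Qed.

Lemma normc_sub_conj_lt c d : 0 < Im c -> Im d < 0 ->
  normc (conjc c - d) < normc (c - d).
Proof.
case: c d => [s t] [s' t'] /= t0 t'0; rewrite ltr_sqrt; first by nra.
by rewrite ltr_wpDl ?sqr_ge0 // exprn_gt0 // subr_gt0; lra.
Qed.

Lemma sigma_dist_ge0 x y : 0 <= sigma_dist D x y.
Proof. by rewrite /sigma_dist; case: ifP => // _; exact: sqrtr_ge0. Qed.

Lemma sigma_dist_leD x y : quadratic_cone D x -> quadratic_cone D y ->
  sigma_dist D x y <= `|x| + `|y|.
Proof.
move=> Qx Qy.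
have [I [J [c [d [[uI uJ xc yd] [-> _ _]]]]]] := sigma_dist_cases Qx Qy.
rewrite xc yd !(norm_slice_emb normA) //.
have -> : normc d = normc (- d) by case: (d) => s t /=; rewrite !sqrrN.
exact: le_normcD.
Qed.

(** If the distance equals [r > 0], a segment from [x] enters the ball at once, so [x] is in the
    closure. A ball of radius 0 is empty, which is why [x = y] is excluded there. *)
Lemma sigma_dist_not_clos x y (r : \bar R) :
  quadratic_cone D x -> quadratic_cone D y -> (0 <= r)%E ->
  ~ closQ D (sigma_ball D y r) x -> (r = 0%E -> x <> y) ->
  (r < (sigma_dist D x y)%:E)%E.
Proof.
move=> Qx Qy r0 nclos xy; rewrite ltNge le_eqVlt; apply/negP => /orP[/eqP sr|sr]; last first.
  by apply: nclos; split=> //; apply: subset_closure.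
apply: nclos; split=> //.
have [I [J [c [d [[uI uJ xc yd] [sE IJ0 IJ]]]]]] := sigma_dist_cases Qx Qy.
have s0 : 0 < sigma_dist D x y.
  rewrite lt0r sigma_dist_ge0 andbT; apply/eqP => s0.
  have cd : c = d.
    by apply/eqP; rewrite -subr_eq0 -normc_eq0 -sE s0.
  have {}xy : x <> y by apply: xy; rewrite -sr s0.
  case: IJ => [IJ|[c0 d0 _]]; first by apply: xy; rewrite xc yd IJ cd.
  by move: c0; rewrite cd ltNge ltW.
case: IJ => [IJ|[c0 d0 noK]].
  (* In a common slice the segment runs straight to [y]. *)
  subst J; apply: (@closure_affine _ _ _ x (y - x)) => e e0 e1.
  have xe : x + e *: (y - x) = slice_emb D I (c + e%:C%C * (d - c)).
    rewrite xc yd slice_embD -slice_embM // slice_emb_real areal_mul.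
    by rewrite slice_embB.
  split; first by rewrite xe; exact: slice_emb_cone.
  rewrite -sr lte_fin (@sigma_dist_same I) //; last 2 first.
    by apply/Cslice_slice_emb; exists (c + e%:C%C * (d - c)).
    by apply/Cslice_slice_emb; exists d.
  have -> : x + e *: (y - x) - y = (1 - e) *: (x - y).
    by rewrite scalerBl scale1r -[y - x]opprB scalerN; zmod.
  rewrite normrZ ger0_norm; last by lra.
  have -> : `|x - y| = sigma_dist D x y.
    by rewrite sE xc yd -slice_embB (norm_slice_emb normA).
  by nra.
(* Otherwise it runs to the real part of [y], which keeps the moving point in the slice of [J]. *)
apply: (@closure_affine _ _ _ x (areal D (Re d) - x)) => e e0 e1.
pose c' := Complex (Re c + e * (Re d - Re c)) ((1 - e) * Im c).
have xe : x + e *: (areal D (Re d) - x) = slice_emb D J c'.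
  rewrite xc /slice_emb /c' /= /areal !(scalerDr, scalerN) !scalerA.
  by rewrite !(mulrDr, scalerDl, mulrDl) mulrN !mul1r mulNr !scaleNr; zmod.
split; first by rewrite xe; exact: slice_emb_cone.
rewrite -sr lte_fin xe yd sigma_dist_other //; last first.
  (* A slice containing the moved point and the real number [Re d] contains [x] as well, since
     [1 - e != 0]. *)
  rewrite -yd -xe => K uK Ky [s [t xst]]; apply: (noK K uK Ky).
  exists ((1 - e)^-1 * (s - e * Re d)), ((1 - e)^-1 * t).
  have e1' : 1 - e != 0 by rewrite subr_eq0 gt_eqF.
  apply: (scalerI e1'); rewrite /areal scalerDr !scalerA !mulVKf //.
  move: xst; rewrite /areal scalerBl scale1r => xst.
  rewrite (_ : _ - _ *: x = x + e *: (Re d *: alt_one D - x) - e *: (Re d *: alt_one D)).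
    by rewrite xst scalerBl scalerA; zmod.
  by rewrite scalerBr; zmod.
rewrite -yd sE.
case: (c) (d) c0 d0 @c' {xe} => [s t] [s' t'] /= t0 t'0.
rewrite ltr_sqrt; last first.
  by rewrite ltr_wpDl ?sqr_ge0 // exprn_gt0 // subr_gt0 (lt_trans t'0).
rewrite (ltr0_norm t'0) gtr0_norm; last by rewrite mulr_gt0 // subr_gt0.
exact: sqr_dist_contract.
Qed.

End distances.

(** * The pseudo-distance u *)

Lemma spherical_contract (R : realType) (c d : R[i]) :
  0 <= Im c -> 0 <= Im d -> 0 < normc ((c - d) * (c - conjc d)) ->
  exists w : R[i], forall e : R, 0 < e -> e < 1 ->
    normc ((c + e%:C%C * w - d) * (c + e%:C%C * w - conjc d)) <
    normc ((c - d) * (c - conjc d)).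
Proof.
case: c d => [s t] [s' t'] t0 t'0 n0; rewrite /= in t0 t'0.
have sqr_lt (u v : R[i]) : normc u ^+ 2 < normc v ^+ 2 -> normc u < normc v.
  by rewrite ltr_pXn2r // nnegrE normc_ge0.
have [ss'|ss'] := eqVneq s s'.
  (* With equal real parts the product is [|t - t'| (t + t')]. Moving [t] towards [t'] may enlarge
     the second factor, but the gain [1 - e] in the first outweighs this. *)
  exists (Complex 0 (t' - t)) => e e0 e1; apply: sqr_lt.
  rewrite !ComplexField.Normc.normcM !exprMn !normc_sqrE /= ss'.
  rewrite [ltLHS](_ : _ = (t - t') ^+ 2 * ((1 - e) * (t + e * (t' - t) + t')) ^+ 2).
    rewrite [ltRHS](_ : _ = (t - t') ^+ 2 * (t + t') ^+ 2); last by ring.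
    have tt : (t - t') * (t + t') != 0.
      move: n0; rewrite lt0r normc_eq0 => /andP[n0 _].
      apply: contra_neq n0 => tt; apply/eqP; rewrite eq_complex /= ss' subrr.
      by rewrite !mul0r mulr0 addr0 opprK tt subr0 eqxx.
    move: tt; rewrite mulf_eq0 negb_or => /andP[tt tt'].
    have tp : 0 < t + t' by rewrite lt0r tt' addr_ge0.
    rewrite ltr_pM2l ?exprn_even_gt0 // ltrXn2r // ?nnegrE ?(ltW tp) //.
      by rewrite mulr_ge0 //; nra.
    rewrite (_ : _ * _ = (1 - e) ^+ 2 * t + (1 - e ^+ 2) * t'); last by ring.
    have h1 : (1 - e) ^+ 2 < 1 by nra.
    have h2 : 1 - e ^+ 2 < 1 by nra.
    nra.
  by ring.
(* With distinct real parts a horizontal move brings the point closer to both [d] and its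
   conjugate. *)
exists (Complex (s' - s) 0) => e e0 e1; rewrite !ComplexField.Normc.normcM.
have ps : 0 < (s - s') ^+ 2 by rewrite exprn_even_gt0 // subr_eq0.
have es : (s + e * (s' - s) - s') ^+ 2 < (s - s') ^+ 2.
  have -> : s + e * (s' - s) - s' = (1 - e) * (s - s') by ring.
  by rewrite exprMn gtr_pMl // exprn_ilt1 //; lra.
apply: ltr_pM; rewrite ?normc_ge0 //; apply: sqr_lt; rewrite !normc_sqrE /=.
  by rewrite !mul0r !mulr0 subr0 !addr0 ltrD2r.
by rewrite !mul0r !mulr0 subr0 !addr0 ltrD2r.
Qed.

Section spherical.
Context {R : realType} {A : normedModType R} (D : alt_star_algebra A).
Context (normA : norm_compatible D) (units : imag_units D !=set0).
Context (C : R) (C_gt0 : 0 < C).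
Local Notation "x ** y" := (alt_mul D x y) (at level 40, left associativity).
Context (mul_le : forall x y, `|x ** y| <= C * `|x| * `|y|).
Implicit Types (x y z w I J K : A) (c d : R[i]).

Lemma Delta_continuous y : continuous (Delta D y).
Proof.
move=> x; rewrite /continuous_at.
pose b h : R := C * (2 * `|x| + `|atr D y|) * `|h - x| + C * `|h - x| ^+ 2.
have hb h : `|Delta D y x - Delta D y h| <= b h.
  have -> : Delta D y x - Delta D y h =
      - (x ** (h - x) + (h - x) ** x - (h - x) ** atr D y + (h - x) ** (h - x)).
    by rewrite /Delta !amulBl !amulBr; zmod.
  rewrite normrN /b [leRHS](_ : _ = C * `|x| * `|h - x| + C * `|h - x| * `|x| +
      C * `|h - x| * `|atr D y| + C * `|h - x| * `|h - x|); last by ring.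
  apply: le_trans (ler_normD _ _) _; apply: lerD; last exact: mul_le.
  apply: le_trans (ler_normB _ _) _; apply: lerD; last exact: mul_le.
  by apply: le_trans (ler_normD _ _) _; apply: lerD; exact: mul_le.
have b0 : b h @[h --> x] --> (0 : R).
  have h0 : `|h - x| @[h --> x] --> (0 : R).
    have := @cvg_norm _ _ _ (nbhs x) _ (fun h => h - x) (x - x).
    rewrite subrr normr0; apply.
    by rewrite -(subrr x); apply: cvgB; [exact: cvg_id|exact: cvg_cst].
  rewrite (_ : 0 = C * (2 * `|x| + `|atr D y|) * 0 + C * (0 * 0)); last by ring.
  apply: cvgD; first by apply: cvgM => //; exact: cvg_cst.
  by apply: cvgM; [exact: cvg_cst|apply: cvgM].
apply/cvgrPdist_le => e e0.
have /cvgr0Pnorm_le/(_ e e0) := b0; apply: filterS => h.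
by apply: le_trans; apply: le_trans (hb h) (ler_norm _).
Qed.

Lemma u_dist_continuous y : continuous (fun x => u_dist D x y).
Proof.
move=> x; apply: continuous_comp; last exact: sqrt_continuous.
by apply: continuous_comp; [exact: Delta_continuous|exact: norm_continuous].
Qed.

Lemma u_distE I J c d : imag_units D I -> imag_units D J ->
  u_dist D (slice_emb D J c) (slice_emb D I d) =
  Num.sqrt (normc ((c - d) * (c - conjc d))).
Proof. by move=> uI uJ; rewrite /u_dist (DeltaE _ _ uI uJ) (norm_slice_emb normA). Qed.

Lemma u_dist_ge0 x y : 0 <= u_dist D x y.
Proof. exact: sqrtr_ge0. Qed.

Lemma sqr_u_dist x y : u_dist D x y ^+ 2 = `|Delta D y x|.
Proof. by rewrite sqr_sqrtr. Qed.

Lemma spherical_norm_le I J c d n b : imag_units D I -> imag_units D J ->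
  `|slice_emb D J (((c - d) * (c - conjc d)) ^+ n) ** b| <=
  C * u_dist D (slice_emb D J c) (slice_emb D I d) ^+ n.*2 * `|b|.
Proof.
move=> uI uJ; rewrite -mul2n exprM sqr_u_dist (DeltaE _ _ uI uJ).
by rewrite (norm_slice_emb normA) // norm_slice_mul_le.
Qed.

(** For odd [n] the power of [Delta] accounts for [n - 1] factors [s] only; the remaining [x - y],
    of norm at most [M], costs a factor [C M / s]. *)
Lemma spherical_term_le x y n a (s M : R) :
  quadratic_cone D x -> quadratic_cone D y -> 0 < s -> u_dist D x y <= s ->
  `|x - y| <= M ->
  `|spherical_term D y n a x| <= (C + C ^+ 2 * M / s) * s ^+ n * `|a|.
Proof.
move=> /(cone_slice_emb units)[J [c [uJ _ xc]]] /(cone_slice_emb units)[I [d [uI _ yd]]].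
move=> s0 us xyM; rewrite {1}xc {1}yd spherical_termE // -yd -xc.
set b := if _ then _ else _.
have M0 : 0 <= M by exact: le_trans xyM.
have C0 := ltW C_gt0.
apply: (@le_trans _ _ (C * s ^+ (n./2).*2 * `|b|)).
  apply: le_trans (@spherical_norm_le I J c d _ b uI uJ) _.
  rewrite -xc -yd ler_wpM2r // ler_pM2l // lerXn2r // ?nnegrE ?u_dist_ge0 //.
  exact: ltW.
rewrite -[in leRHS](odd_double_half n) exprD /b.
case: odd; rewrite /= ?expr0 ?expr1 ?mul1r; last first.
  rewrite ler_wpM2r // ler_wpM2r ?exprn_ge0 ?(ltW s0) // lerDl.
  by rewrite !mulr_ge0 ?invr_ge0 ?exprn_ge0 ?(ltW s0).
set t := s ^+ _; have t0 : 0 < t by rewrite exprn_gt0.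
rewrite [leRHS](_ : _ = C * t * (s * `|a| + C * M * `|a|)); last first.
  by field; rewrite gt_eqF.
rewrite ler_pM2l ?mulr_gt0 //; apply: le_trans (mul_le _ _) _.
apply: ler_wpDl; first by rewrite mulr_ge0 // ltW.
by rewrite ler_wpM2r // ler_pM2l.
Qed.

Lemma spherical_term_ge x y : quadratic_cone D x -> quadratic_cone D y ->
  0 < u_dist D x y -> exists2 e : R, 0 < e & forall n a, quadratic_cone D a ->
    e * (`|a| * u_dist D x y ^+ n) <= `|spherical_term D y n a x|.
Proof.
move=> /(cone_slice_emb units)[J [c [uJ _ xc]]] /(cone_slice_emb units)[I [d [uI _ yd]]].
set s := u_dist D x y => s0.
have xy0 : 0 < `|x - y|.
  rewrite normr_gt0 subr_eq0; apply/eqP => xy; move: s0; rewrite /s xy /u_dist.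
  have -> : Delta D y y = 0.
    by rewrite yd (DeltaE _ _ uI uI) subrr mul0r (slice_emb_real D I 0) /areal scale0r.
  by rewrite normr0 sqrtr0 ltxx.
(* The two entries serve even and odd [n]. *)
exists (Num.min C^-1 (`|x - y| / (C ^+ 2 * s))).
  by rewrite lt_min invr_gt0 C_gt0 divr_gt0 // mulr_gt0 // exprn_gt0.
move=> n a Qa; rewrite {2}xc {2}yd spherical_termE // -yd -xc.
set b := if _ then _ else _.
set T := _ ** b.
have Tge : s ^+ (n./2).*2 * `|b| <= C * `|T|.
  rewrite -mul2n exprM sqr_u_dist xc yd (DeltaE _ _ uI uJ).
  rewrite (norm_slice_emb normA) // -normcX -(norm_slice_emb normA _ uJ).
  by apply: (cone_mul_ge normA units C_gt0 mul_le); exact: slice_emb_cone.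
have -> : s ^+ n = s ^+ odd n * s ^+ (n./2).*2 by rewrite -exprD odd_double_half.
move: Tge; rewrite /b.
set t := s ^+ _; have t0 : 0 < t by rewrite exprn_gt0.
have na : 0 <= `|a| by [].
case: odd; rewrite /= ?expr0 ?expr1 ?mul1r => Tge; last first.
  apply: (@le_trans _ _ (C^-1 * (`|a| * t))).
    by rewrite ler_wpM2r ?ge_min ?lexx // mulr_ge0 // ltW.
  by rewrite ler_pdivrMl // mulrC.
apply: (@le_trans _ _ (`|x - y| / (C ^+ 2 * s) * (`|a| * (s * t)))).
  by rewrite ler_wpM2r ?ge_min ?lexx ?orbT // !mulr_ge0 // ltW.
rewrite [leLHS](_ : _ = t * (`|x - y| * `|a|) / C ^+ 2); last first.
  by field; rewrite !gt_eqF.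
rewrite ler_pdivrMr ?exprn_gt0 //.
(* [x - y] need not lie in the cone, so it is [a] that gets inverted. *)
apply: (@le_trans _ _ (t * (C * `|(x - y) ** a|))).
  by rewrite ler_pM2l //; exact: (mul_cone_ge normA units C_gt0 mul_le).
rewrite mulrCA [leRHS](_ : _ = C * (C * `|T|)); last by ring.
by rewrite ler_pM2l.
Qed.

Lemma u_dist_not_clos x y (r : \bar R) :
  quadratic_cone D x -> quadratic_cone D y -> (0 <= r)%E ->
  ~ closQ D (u_ball D y r) x -> (r = 0%E -> u_dist D x y <> 0) ->
  (r < (u_dist D x y)%:E)%E.
Proof.
move=> Qx Qy r0 nclos xy; rewrite ltNge le_eqVlt; apply/negP => /orP[/eqP sr|sr]; last first.
  by apply: nclos; split=> //; apply: subset_closure.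
apply: nclos; split=> //.
have s0 : 0 < u_dist D x y.
  rewrite lt0r u_dist_ge0 andbT; apply/eqP => s0.
  by apply: xy => //; rewrite -sr s0.
rewrite -sr.
have [J [c [uJ c0 xc]]] := cone_slice_emb units Qx.
have [I [d [uI d0 yd]]] := cone_slice_emb units Qy.
suff [w hw] : exists w : R[i], forall e : R, 0 < e -> e < 1 ->
    normc ((c + e%:C%C * w - d) * (c + e%:C%C * w - conjc d)) <
    normc ((c - d) * (c - conjc d)).
  apply: (@closure_affine _ _ _ _ (slice_emb D J w)) => e e0 e1.
  have -> : x + e *: slice_emb D J w = slice_emb D J (c + e%:C%C * w).
    by rewrite xc slice_embD -slice_embM // slice_emb_real areal_mul.
  split; first exact: slice_emb_cone.
  rewrite lte_fin xc yd !u_distE // ltr_sqrt ?hw //.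
  by move: s0; rewrite xc yd u_distE // sqrtr_gt0.
have n0 : 0 < normc ((c - d) * (c - conjc d)).
  by move: s0; rewrite xc yd u_distE // sqrtr_gt0.
exact: spherical_contract.
Qed.

End spherical.

(** * The radii of convergence *)

Section sigma_uniform.
Context {R : realType} {A : normedModType R} (D : alt_star_algebra A).
Context (normA : norm_compatible D) (units : imag_units D !=set0).

Lemma dist_continuous (y : A) : continuous (fun x => `|x - y|).
Proof.
move=> x; apply: (@continuous_comp _ _ _ (fun x => x - y)).
  by apply: cvgB; [exact: cvg_id|exact: cvg_cst].
exact: norm_continuous.
Qed.

(** [sigma_dist] need not attain a maximum on a compact set. It is bounded by norms if [r] is
    infinite, and it is [|x - y|] on [L] if [y] is real or [r <= |Im y|]; the remaining case is the
    uniformity assumption. *)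
Lemma sigma_dist_uniform (y : A) (r : \bar R) (L : set A) :
  quadratic_cone D y -> L !=set0 -> L `<=` quadratic_cone D -> compact L ->
  L `<=` sigma_ball D y r ->
  (~ range (areal D) y -> (`|aIm D y|%:E < r)%E -> (r < +oo)%E ->
     exists2 s : R, (s%:E < r)%E & L `<=` sigma_ball D y s%:E) ->
  exists2 s : R, (s%:E < r)%E & forall x, L x -> sigma_dist D x y <= s.
Proof.
move=> Qy L0 LQ cL Lr unif.
have [->|rfin] := eqVneq r +oo%E.
  have [|s _ Ls] := compact_lt_bound L0 cL (@dist_continuous 0) (r := +oo%E).
    by move=> x _; rewrite ltry.
  exists (s + `|y|); first by rewrite ltry.
  move=> x Lx; apply: le_trans (sigma_dist_leD normA units (LQ _ Lx) Qy) _.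
  by rewrite lerD2r -[x in `|x|]subr0 Ls.
suff dist_case : (forall x, L x -> sigma_dist D x y = `|x - y|) ->
    exists2 s : R, (s%:E < r)%E & forall x, L x -> sigma_dist D x y <= s.
  have [yreal|ynreal] := pselect (range (areal D) y).
    apply: dist_case => x Lx; have [t _ ty] := yreal.
    have [J [c [uJ _ xc]]] := cone_slice_emb units (LQ _ Lx).
    apply: (sigma_dist_same uJ); apply/Cslice_slice_emb; first by exists c.
    by exists t%:C%C; rewrite slice_emb_real.
  have [yr|ry] := ltP `|aIm D y|%:E r.
    have [|s sr Ls] := unif ynreal yr; first by rewrite lt_neqAle rfin leey.
    by exists s => // x /Ls[_]; rewrite lte_fin => /ltW.
  (* A point sharing no slice with [y] has distance at least [|Im y|], so the ball contains none. *)
  apply: dist_case => x Lx; have [_] := Lr _ Lx; rewrite ltNge.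
  rewrite /sigma_dist; case: asboolP => // _ /negP[]; apply: le_trans ry _.
  rewrite lee_fin; apply: (@le_trans _ _ (`|aIm D x| + `|aIm D y|)).
    by rewrite lerDr.
  rewrite -[leLHS]ger0_norm ?addr_ge0 // -sqrtr_sqr ler_sqrt ?addr_ge0 ?sqr_ge0 //.
  by rewrite lerDr sqr_ge0.
move=> sigmaE; have [|s sr Ls] := compact_lt_bound L0 cL (@dist_continuous y) (r := r).
  by move=> x Lx; rewrite -sigmaE //; exact: (Lr _ Lx).2.
by exists s => // x Lx; rewrite sigmaE // Ls.
Qed.

End sigma_uniform.

(** The uniformity clause excludes compact sets in the ball on which [sigma_dist] comes arbitrarily
    close to a finite [r]. The clauses at [r = 0] concern empty balls: the power series still
    converges at [y], where its terms with [n >= 1] vanish, and the spherical one where [u_dist] is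
    0, since there [Delta] kills the terms with [n >= 2]. *)
Theorem theorem3p4 (R : realType) (A : normedModType R)
    (D : alt_star_algebra A)
    (findimA : finite_dimensional A)
    (normA : norm_compatible D)
    (units_neq0 : imag_units D !=set0)
    (y : A) (Qy : quadratic_cone D y)
    (a : nat -> A) (r : \bar R) (r_ge0 : (0 <= r)%E)
    (r_def : limn_esup (fun n => (`|a n| `^ (n%:R)^-1)%:E) = (r^-1)%E) :
  ((forall L : set A, L `<=` quadratic_cone D -> compact L ->
      L `<=` sigma_ball D y r ->
      (~ range (areal D) y -> (`|aIm D y|%:E < r)%E -> (r < +oo)%E ->
         exists2 s : R, (s%:E < r)%E & L `<=` sigma_ball D y s%:E) ->
      converges_totally (fun n => power_term D y n (a n)) L)
   /\
   ((forall n, quadratic_cone D (a n)) ->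
    forall x, (quadratic_cone D `\` closQ D (sigma_ball D y r)) x ->
      (r = 0%E -> x <> y) ->
      ~ converges_at (fun n => power_term D y n (a n)) x))
  /\
  ((forall L : set A, L `<=` quadratic_cone D -> compact L ->
      L `<=` u_ball D y r ->
      converges_totally (fun n => spherical_term D y n (a n)) L)
   /\
   ((forall n, quadratic_cone D (a n)) ->
    forall x, (quadratic_cone D `\` closQ D (u_ball D y r)) x ->
      (r = 0%E -> u_dist D x y <> 0) ->
      ~ converges_at (fun n => spherical_term D y n (a n)) x)).
Proof.
have [C C_gt0 mul_le] := bounded_bilinear (alt_mul D) findimA.
have a_ge0 n : 0 <= `|a n| by [].
(* Common scheme for both series: a distance bound [s < r] and term bounds at every radius [t >= s]
   reduce total convergence to the root test. *)
have total (g : nat -> A -> A) (d : A -> R) (L : set A) (s : R) :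
    L !=set0 -> (forall x, L x -> 0 <= d x) ->
    (forall x, L x -> d x <= s) -> (s%:E < r)%E ->
    (forall t : R, 0 < t -> s <= t -> exists2 K, 0 <= K &
       forall n x, L x -> `|g n x| <= K * t ^+ n * `|a n|) ->
    converges_totally g L.
  move=> [x0 Lx0] d0 ds sr gK.
  have r0 : (0 < r)%E.
    by apply: le_lt_trans sr; rewrite lee_fin; exact: le_trans (d0 _ Lx0) (ds _ Lx0).
  have [t [t0 tr st]] := ereal_lt_pos_ge r0 sr.
  have [B [q [q0 q1 aq]]] := root_test_lt a_ge0 r_def t0 tr.
  have [M M0 gM] := gK t t0 st.
  apply: (@converges_totally_geometric _ _ _ _ (M * B) q) => // n x Lx.
  apply: le_trans (gM n x Lx) _; rewrite -!mulrA ler_wpM2l //.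
  by rewrite mulrC aq.
(* Beyond the radius, [|a n| * s ^+ n >= 1] for infinitely many [n], so the terms do not tend to
   0. *)
have diverges (g : nat -> A -> A) x (s e : R) N : 0 < s -> (r < s%:E)%E -> 0 < e ->
    (forall n, (N <= n)%N -> e * (`|a n| * s ^+ n) <= `|g n x|) ->
    ~ converges_at g x.
  move=> s0 rs e0 ge; apply: (not_converges_at e0) => N'.
  have [n Nn an] := root_test_gt a_ge0 r_def r_ge0 s0 rs (maxn N N').
  exists n; first by exact: leq_trans (leq_maxr _ _) Nn.
  apply: le_trans (ge n (leq_trans (leq_maxl _ _) Nn)).
  by rewrite ler_peMr // ltW.
have empty (g : nat -> A -> A) : converges_totally g set0.
  by apply: (@converges_totally_geometric _ _ _ _ 0 0).
split; split.
- move=> L LQ cL Lr unif.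
  have [L0|/nonemptyPn ->] := pselect (L !=set0); last exact: empty.
  have [s sr Ls] := sigma_dist_uniform normA units_neq0 Qy L0 LQ cL Lr unif.
  apply: (total _ (fun x => sigma_dist D x y) L s) => //.
    by move=> x _; exact: sigma_dist_ge0.
  move=> t t0 st; exists (2 * C ^+ 3).
    by rewrite mulr_ge0 // exprn_ge0 // ltW.
  move=> n x Lx.
  have [I [J [c [d [[uI uJ xc yd] [sE _ IJ]]]]]] :=
    sigma_dist_cases normA units_neq0 (LQ _ Lx) Qy.
  have cd : normc (c - d) <= t by rewrite -sE (le_trans (Ls _ Lx)).
  rewrite xc yd; apply: (power_term_le normA C_gt0 mul_le) => //.
  case: IJ => [|[c0 d0 _]]; [by left|right].
  by apply: le_trans cd; apply: ltW; exact: normc_sub_conj_lt.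
- move=> Qa x [Qx nclos] xy.
  have := sigma_dist_not_clos normA units_neq0 Qx Qy r_ge0 nclos xy.
  have [I [J [c [d [[uI uJ xc yd] [-> IJ0 IJ]]]]]] :=
    sigma_dist_cases normA units_neq0 Qx Qy.
  move=> rs; have s0 : 0 < normc (c - d).
    by rewrite -lte_fin; exact: le_lt_trans rs.
  have [|e e0 [N ge]] := power_term_ge normA units_neq0 C_gt0 mul_le uI uJ IJ0 s0.
    by case: IJ => [|[c0 d0 _]]; [left|right; exact: normc_sub_conj_lt].
  apply: (diverges _ _ _ e N s0 rs e0) => n Nn.
  by rewrite xc yd; apply: ge.
- move=> L LQ cL Lr.
  have [L0|/nonemptyPn ->] := pselect (L !=set0); last exact: empty.
  (* Unlike [sigma_dist], the pseudo-distance [u_dist] is continuous, and compactness alone gives a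
     bound below [r]. *)
  have [x Lx|s sr Ls] := compact_lt_bound L0 cL (@u_dist_continuous _ _ D _ mul_le y) (r := r).
    exact: (Lr _ Lx).2.
  have [|M _ LM] := compact_lt_bound L0 cL (@dist_continuous _ _ y) (r := +oo%E).
    by move=> x _; rewrite ltry.
  apply: (total _ (fun x => u_dist D x y) L s) => //.
    by move=> x _; exact: u_dist_ge0.
  move=> t t0 st; exists (C + C ^+ 2 * M / t).
    have M0 : 0 <= M by have [x Lx] := L0; apply: le_trans (LM _ Lx).
    by rewrite addr_ge0 ?(ltW C_gt0) // divr_ge0 ?(ltW t0) // mulr_ge0 // sqr_ge0.
  move=> n x Lx.
  apply: (spherical_term_le normA units_neq0 C_gt0 mul_le) => //.
  - exact: LQ.
  - by rewrite (le_trans (Ls _ Lx)).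
  - exact: LM.
- move=> Qa x [Qx nclos] xy.
  have rs := u_dist_not_clos normA units_neq0 Qx Qy r_ge0 nclos xy.
  have s0 : 0 < u_dist D x y by rewrite -lte_fin; exact: le_lt_trans rs.
  have [e e0 ge] := spherical_term_ge normA units_neq0 C_gt0 mul_le Qx Qy s0.
  by apply: (diverges _ _ _ e 0%N s0 rs e0) => n _; apply: ge.
Qed.
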